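(* In the deep inverse Rosenblatt transport (DIRT) setting described in the context, let $\hat\pi_k$ be the approximate unnormalised density obtained with $\tilde g_1,\dots,\tilde g_k$ constructed using either the exact ratio functions or the approximate ratio functions, and suppose $$\big\|\sqrt{\pi_k}-\sqrt{\hat\pi_k}\big\|_{L^2_\lambda(\mathcal X)}\le e_k .$$ Then $$D_{\rm H}\big(\nu_k\,\|\,(\bar T_k)_\sharp\mu\big)\le\frac{\sqrt2\,e_k}{\sqrt{z_k}},\qquad D_{\rm TV}\big(\nu_k\,\|\,(\bar T_k)_\sharp\mu\big)\le\frac{2\,e_k}{\sqrt{z_k}},$$ and $$D_{\chi^2}\big(\nu_k\,\|\,(\bar T_k)_\sharp\mu\big)\le\Big(\nu_k\big(\pi_k^2/\hat\pi_k^2\big)^{1/2}+\big((\bar T_k)_\sharp\mu\big)\big(\pi_k^2/\hat\pi_k^2\big)^{1/2}\Big)\,\frac{2\,\bar z_k}{z_k\sqrt{z_k}}\;e_k .$$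
   Context: Spaces and weights: $\mathcal X=\prod_{i=1}^d\mathcal X_i$, $\mathcal U=\prod_{i=1}^d\mathcal U_i$ with $\mathcal X_i,\mathcal U_i\subseteq\mathbb R$; $\lambda(x)=\prod_i\lambda_i(x_i)$ and $\omega(u)=\prod_i\omega_i(u_i)$ are product weight functions (positive), with $\lambda(\mathcal X)=\int_{\mathcal X}\lambda$ and $\omega(\mathcal U)=\int_{\mathcal U}\omega$ finite. $\|f\|_{L^2_\lambda(\mathcal X)}^2=\int_{\mathcal X}f^2\lambda\,dx$. Reference: $\mu$ is a product probability measure on $\mathcal U$ with density $f_U(u)=\prod_i f_{U_i}(u_i)>0$; $R(u)=(F_{U_1}(u_1),\ldots,F_{U_d}(u_d))$ is the map of its marginal cumulative distribution functions, so $R_\sharp\mu=\mu_{\rm uni}$, the uniform measure on $[0,1]^d$. Bridging densities: $\pi_0,\ldots,\pi_L$ are nonnegative unnormalised densities on $\mathcal X$ with $z_k=\int_{\mathcal X}\pi_k\lambda\,dx\in(0,\infty)$; $\nu_k$ is the probability measure with density $\frac1{z_k}\pi_k\lambda$. Standing assumptions: $\sup_{\mathcal X}\pi_0<\infty$, $\sup_{\mathcal X}\pi_k/\pi_j<\infty$ for all $j<k$, and $\sup_{x\in\mathcal X}\pi_k(x)/\hat\pi_k(x)<\infty$. The inverse Rosenblatt transport of a density $p$ on a product domain is the inverse of the lower-triangular map $(F_1(x_1),F_2(x_2|x_1),\ldots,F_d(x_d|x_{1},\ldots,x_{d-1}))$ of its marginal/conditional cumulative distribution functions; it pushes $\mu_{\rm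 uni}$ forward to the measure with density $p$. DIRT: Layer $0$: $\tilde g_0:\mathcal X\to\mathbb R$ is a tensor-train function (product of univariate matrix-valued functions $\mathsf G_1(x_1)\cdots\mathsf G_d(x_d)$, a scalar) approximating $\sqrt{\pi_0}$, $\gamma_0>0$, $\hat z_0=\gamma_0\lambda(\mathcal X)+\int_{\mathcal X}\tilde g_0^2\lambda\,dx$, and $\hat T_0:[0,1]^d\to\mathcal X$ is the inverse Rosenblatt transport of $\hat f_0(x)=\frac1{\hat z_0}(\gamma_0+\tilde g_0(x)^2)\lambda(x)$. Layers $j\ge1$: $\tilde g_j:\mathcal U\to\mathbb R$ is a tensor-train function, $\gamma_j>0$, $\hat z_j=\gamma_j\omega(\mathcal U)+\int_{\mathcal U}\tilde g_j^2\omega\,du$, and $\hat T_j:[0,1]^d\to\mathcal U$ is the inverse Rosenblatt transport of $\hat p_j(u)=\frac1{\hat z_j}(\gamma_j+\tilde g_j(u)^2)\omega(u)$. The composition is $\bar T_j=(\hat T_0\circ R)\circ\cdots\circ(\hat T_j\circ R):\mathcal U\to\mathcal X$. The maps are treated as diffeomorphisms (up to null sets). In the exact ratio approach $\tilde g_j$ approximates $q_j=\Big(\frac{\pi_j\circ\bar T_{j-1}}{\hat\pi_{j-1}\circ\bar T_{j-1}}\frac{f_U}{\omega}\Big)^{1/2}$; in the approximate ratio approach it approximates $\tilde q_j=\Big(\frac{\pi_j\circ\bar T_{j-1}}{\pi_{j-1}\circ\bar T_{j-1}}\frac{f_U}{\omega}\Big)^{1/2}$. Approximate densities: with $\bar z_k=\prod_{j=0}^k\hat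 z_j$, $$\hat\pi_k(x)=\big(\gamma_0+\tilde g_0(x)^2\big)\prod_{j=1}^k\frac{\big(\gamma_j+(\tilde g_j\circ\bar T_{j-1}^{-1})(x)^2\big)\,(\omega\circ\bar T_{j-1}^{-1})(x)}{(f_U\circ\bar T_{j-1}^{-1})(x)} ,$$ and $(\bar T_k)_\sharp\mu$ has the density $\frac1{\bar z_k}\hat\pi_k(x)\lambda(x)$. For a measure $\nu$ and function $h$, $\nu(h)=\int h\,d\nu$, and $\nu(h)^{1/2}$ means $(\nu(h))^{1/2}$. For probability measures with Lebesgue densities $p,q$: $D_{\rm H}=\big(\frac12\int(\sqrt p-\sqrt q)^2\big)^{1/2}$, $D_{\rm TV}=\frac12\int|p-q|$, and $D_{\chi^2}(p\|q)=\int (p/q)^2q\,dx-1$. *)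

(* Defs.v *)
From HB Require Import structures.
From mathcomp Require Import all_boot all_order all_algebra.
From mathcomp Require Import all_classical all_reals all_analysis.

Set Implicit Arguments.
Unset Strict Implicit.
Unset Printing Implicit Defensive.
Import Order.TTheory GRing.Theory Num.Theory.
Import numFieldNormedType.Exports.

Local Open Scope classical_set_scope.
Local Open Scope ring_scope.

(* R^d is the type d.-tuple R with its product sigma-algebra. *)
Definition tuple_cons (R : realType) (n : nat) (x : R * n.-tuple R) :
  n.+1.-tuple R := [the n.+1.-tuple R of x.1 :: x.2].

(* Lebesgue measure on R^n: the product of n copies of the one-dimensional
   one, carried to tuples along (t, z) |-> t :: z. *)
Fixpoint leb (R : realType) (n : nat) : set (n.-tuple R) -> \bar R :=
  if n isn't m.+1 then \d_([tuple] : 0.-tuple R)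
  else pushforward (@lebesgue_measure R \x @leb R m)%E (@tuple_cons R m).
Arguments leb {R} n _.

Section lebesgue_on_tuples.
Context {R : realType}.
Implicit Types n : nat.

Lemma measurable_tuple_cons n : measurable_fun setT (@tuple_cons R n).
Proof. exact: measurable_cons. Qed.

Lemma pushforward_cons_sigma_finite n
    (m : {measure set (measurableTypeR R * n.-tuple R)%type -> \bar R}) :
  sigma_finite setT m -> sigma_finite setT (pushforward m (@tuple_cons R n)).
Proof.
move=> [F FT Foo].
pose uncons (x : n.+1.-tuple R) := (thead x, [tuple of behead x]).
have unconsK x : tuple_cons (uncons x) = x by rewrite [RHS]tuple_eta.
have consK : cancel (@tuple_cons R n) uncons.
  by case=> t z; rewrite /uncons theadE; congr pair; exact/val_inj.
have muncons : measurable_fun setT uncons.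
  apply: measurable_fun_pair; first exact: measurable_tnth.
  exact: measurable_behead.
exists (fun i => uncons @^-1` F i).
  by rewrite -preimage_bigcup -FT preimage_setT.
move=> i; have [mFi Fioo] := Foo i; split.
  by rewrite -[X in measurable X]setTI; exact: muncons.
rewrite /pushforward -comp_preimage.
by rewrite (_ : _ @^-1` _ = F i)//; apply/seteqP; split=> x /=; rewrite consK.
Qed.

Lemma leb_sigma_finite_measure n :
  exists m : {sigma_finite_measure set (n.-tuple R) -> \bar R}, leb n = m.
Proof.
elim: n => [|n [m lebm]]; first by exists (\d_([tuple] : 0.-tuple R)).
pose p : {measure set _ -> \bar R} := (@lebesgue_measure R \x m)%E.
have [p_sf] :=
  lebesgue_integral_fubini.measure_function_Measure_isSigmaFinite__to__measure_function_isSigmaFinite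
    (@lebesgue_measure R) m.
pose pm : {measure set _ -> \bar R} :=
  measure_function_pushforward__canonical__measure_function_Measure
    p (@measurable_tuple_cons n).
pose sfm := Measure_isSigmaFinite.Build _ _ _ pm
  (@pushforward_cons_sigma_finite n p p_sf).
pose psf : {sigma_finite_measure set _ -> \bar R} :=
  HB.pack (pm : set _ -> _) pm sfm.
by exists psf; rewrite /= lebm.
Qed.

Let leb0 n : leb n set0 = 0%E :> \bar R.
Proof. by have [m ->] := leb_sigma_finite_measure n. Qed.

Let leb_ge0 n A : (0 <= leb n A :> \bar R)%E.
Proof. by have [m ->] := leb_sigma_finite_measure n. Qed.

Let leb_sigma_additive n : semi_sigma_additive (@leb R n).
Proof.
have [m ->] := leb_sigma_finite_measure n.
exact: measure_semi_sigma_additive.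
Qed.

HB.instance Definition _ n := isMeasure.Build _ _ _ (@leb R n)
  (leb0 n) (@leb_ge0 n) (@leb_sigma_additive n).

Let leb_sigma_finite n : sigma_finite setT (@leb R n).
Proof. by have [m ->] := leb_sigma_finite_measure n; exact: sigma_finiteT. Qed.

HB.instance Definition _ n := Measure_isSigmaFinite.Build _ _ _ (@leb R n)
  (@leb_sigma_finite n).

End lebesgue_on_tuples.

Section boxes.
Context {R : realType} {d : nat}.
Implicit Types (D : 'I_d -> set R) (w : 'I_d -> R -> R) (x : d.-tuple R).

Definition box D : set (d.-tuple R) := [set x | forall i, D i (tnth x i)].

Definition unit_cube : set (d.-tuple R) := box (fun=> `[0%R, 1%R]%classic).

Definition prodfun w x : R := \prod_(i < d) w i (tnth x i).

End boxes.

Definition L2norm (R : realType) (d : nat) (D : set (d.-tuple R))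
    (w f : d.-tuple R -> R) : \bar R :=
  ((\int[leb d]_(x in D) (f x ^+ 2 * w x)%:E) `^ 2^-1%R)%E.

Fixpoint tt_prod (R : realType) (r : nat -> nat)
    (G : forall i, R -> 'M[R]_(r i, r i.+1)) (x : nat -> R) (m : nat) :
    'M[R]_(r 0%N, r m) :=
  if m isn't m'.+1 then 1%:M else tt_prod G x m' *m G m' (x m').

(* The cores are indexed from 0; the two outer ranks are 1, so that the
   product has a single entry. *)
Definition tt_function (R : realType) (d : nat) (D : set (d.-tuple R))
    (g : d.-tuple R -> R) : Prop :=
  exists (r : nat -> nat) (G : forall i, R -> 'M[R]_(r i, r i.+1)),
  [/\ r 0%N = 1%N, r d = 1%N &
      forall x, D x -> forall a b, g x = tt_prod G (nth 0 x) d a b].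

Section rosenblatt.
Context {R : realType} {d : nat}.
Implicit Types (D : set (d.-tuple R)) (p : d.-tuple R -> R) (x : d.-tuple R).

(* (x_0, ..., x_(m-1), z_0, ..., z_(d-m-1)) *)
Definition splice (m : nat) x (z : seq R) : d.-tuple R :=
  [tuple if (i < m)%N then tnth x i else nth 0 z (i - m) | i < d].

(* F_i(x_i | x_0, ..., x_(i-1)): the later coordinates are integrated out, and
   coordinate i is integrated up to x_i in the numerator and over everything in
   the denominator. *)
Definition cond_cdf D p (i : 'I_d) x : R :=
  (\int[leb (d - i)]_(z in [set z | D (splice i x z) /\ nth 0 z 0%N <= tnth x i])
      p (splice i x z)) /
  (\int[leb (d - i)]_(z in [set z | D (splice i x z)]) p (splice i x z)).

Definition rosenblatt D p x : d.-tuple R := [tuple cond_cdf D p i x | i < d].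

Definition inverse_up_to_null (A B : set (d.-tuple R))
    (F G : d.-tuple R -> d.-tuple R) : Prop :=
  [/\ measurable_fun B G,
      forall y, B y -> A (G y),
      {ae leb d, forall x, A x -> G (F x) = x} &
      {ae leb d, forall y, B y -> F (G y) = y}].

Definition inverse_rosenblatt D p (T : d.-tuple R -> d.-tuple R) : Prop :=
  inverse_up_to_null D unit_cube (rosenblatt D p) T.

End rosenblatt.

Section divergences.
Context {R : realType} {d : nat}.
Implicit Types (m : set (d.-tuple R) -> \bar R) (p : d.-tuple R -> R).
Local Open Scope ereal_scope.

Definition density_measure (D : set (d.-tuple R)) p :
    set (d.-tuple R) -> \bar R :=
  fun A => \int[leb d]_(x in A `&` D) (p x)%:E.

Definition is_density m p : Prop :=
  [/\ measurable_fun setT p, forall x, (0 <= p x)%R &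
      forall A, measurable A -> m A = \int[leb d]_(x in A) (p x)%:E].

(* a chosen density of m, if there is one; it is unique up to null sets *)
Definition density_of m : d.-tuple R -> R :=
  xget (cst 0%R) [set p | is_density m p].

Definition D_H m1 m2 : \bar R :=
  let p := density_of m1 in let q := density_of m2 in
  (2^-1%:E * \int[leb d]_x ((Num.sqrt (p x) - Num.sqrt (q x)) ^+ 2)%:E) `^ 2^-1%R.

Definition D_TV m1 m2 : \bar R :=
  let p := density_of m1 in let q := density_of m2 in
  2^-1%:E * \int[leb d]_x `|p x - q x|%:E.

(* Without absolute continuity p / q has no meaning where q = 0 < p (and
   division by 0 is 0 in R), whence the usual convention +oo. *)
Definition D_chi2 m1 m2 : \bar R :=
  let p := density_of m1 in let q := density_of m2 in
  if `[< m1 `<< m2 >]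
  then \int[leb d]_x ((p x / q x) ^+ 2 * q x)%:E - 1 else +oo.

End divergences.

(* Layer 0 lives on X with weight lambda, the layers j >= 1 on U with weight
   omega.  Functions are total; only their values on X, U or [0,1]^d matter. *)
Record dirt (R : realType) (d : nat) := Dirt {
  domX : 'I_d -> set R;
  domU : 'I_d -> set R;
  lambda_ : 'I_d -> R -> R;
  omega_ : 'I_d -> R -> R;
  fU_ : 'I_d -> R -> R;
  nlayers : nat;
  bridge : nat -> d.-tuple R -> R;                  (* pi_k *)
  tt_approx : nat -> d.-tuple R -> R;                  (* \tilde g_j *)
  gam : nat -> R;                                   (* gamma_j *)
  transport : nat -> d.-tuple R -> d.-tuple R;      (* \hat T_j *)
  refmap_inv : d.-tuple R -> d.-tuple R             (* inverse of refmap below *)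
}.

Section dirt_definitions.
Context {R : realType} {d : nat} (S : dirt R d).
Implicit Types (x u : d.-tuple R) (j k : nat).

Definition spaceX := box (domX S).
Definition spaceU := box (domU S).
Definition lam := prodfun (lambda_ S).
Definition omg := prodfun (omega_ S).
Definition fU := prodfun (fU_ S).

Definition ref_measure := density_measure spaceU fU.

(* the map R of marginal cumulative distribution functions *)
Definition refmap u : d.-tuple R :=
  [tuple \int[lebesgue_measure]_(t in domU S i `&` `]-oo, tnth u i]) fU_ S i t
  | i < d].

Definition znorm k : R := \int[leb d]_(x in spaceX) (bridge S k x * lam x).

Definition nu_target k :=
  density_measure spaceX (fun x => bridge S k x * lam x / znorm k).

Definition layer_dom j := if j is 0 then spaceX else spaceU.
Definition layer_wgt j := if j is 0 then lam else omg.

Definition zhat j : R :=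
  gam S j * (\int[leb d]_(x in layer_dom j) layer_wgt j x) +
  \int[leb d]_(x in layer_dom j) (tt_approx S j x ^+ 2 * layer_wgt j x).

(* \hat f_0 for j = 0, \hat p_j for j >= 1 *)
Definition layer_density j x : R :=
  (gam S j + tt_approx S j x ^+ 2) * layer_wgt j x / zhat j.

Definition layer_map j u := transport S j (refmap u).

(* inverse of [layer_map j], using that \hat T_j inverts a Rosenblatt map *)
Definition layer_map_inv j x :=
  refmap_inv S (rosenblatt (layer_dom j) (layer_density j) x).

Fixpoint Tbar j : d.-tuple R -> d.-tuple R :=
  if j isn't i.+1 then layer_map 0 else Tbar i \o layer_map i.+1.

Fixpoint Tbar_inv j : d.-tuple R -> d.-tuple R :=
  if j isn't i.+1 then layer_map_inv 0 else layer_map_inv i.+1 \o Tbar_inv i.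

Definition pihat k x : R :=
  (gam S 0 + tt_approx S 0 x ^+ 2) *
  \prod_(1 <= j < k.+1)
    let u := Tbar_inv j.-1 x in
    (gam S j + tt_approx S j u ^+ 2) * omg u / fU u.

Definition zbar k : R := \prod_(0 <= j < k.+1) zhat j.

Inductive ratio_approach := ExactRatio | ApproximateRatio.

Definition exact_ratio j u : R :=
  let x := Tbar j.-1 u in
  Num.sqrt (bridge S j x / pihat j.-1 x * (fU u / omg u)).

Definition approximate_ratio j u : R :=
  let x := Tbar j.-1 u in
  Num.sqrt (bridge S j x / bridge S j.-1 x * (fU u / omg u)).

Definition layer_target (a : ratio_approach) j x : R :=
  if j is 0 then Num.sqrt (bridge S 0 x)
  else if a is ExactRatio then exact_ratio j x else approximate_ratio j x.

Definition approximates (a : ratio_approach) (eps : R) j : Prop :=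
  (L2norm (layer_dom j) (layer_wgt j)
     (fun x => tt_approx S j x - layer_target a j x)%R <= eps%:E)%E.

(* In \bar R, r / 0 is +oo for r > 0 and 0 / 0 = 0. *)
Definition sup_ratio_finite (f g : d.-tuple R -> R) : Prop :=
  (ereal_sup [set (f x)%:E / (g x)%:E | x in spaceX] < +oo)%E.

Record dirt_assumptions : Prop := DirtAssumptions {
  measurable_domX : forall i, measurable (domX S i);
  measurable_domU : forall i, measurable (domU S i);
  measurable_lambda : forall i, measurable_fun (domX S i) (lambda_ S i);
  lambda_gt0 : forall i t, domX S i t -> 0 < lambda_ S i t;
  lambda_finite : (\int[leb d]_(x in spaceX) (lam x)%:E < +oo)%E;
  measurable_omega : forall i, measurable_fun (domU S i) (omega_ S i);
  omega_gt0 : forall i t, domU S i t -> 0 < omega_ S i t;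
  omega_finite : (\int[leb d]_(u in spaceU) (omg u)%:E < +oo)%E;
  measurable_fU : forall i, measurable_fun (domU S i) (fU_ S i);
  fU_gt0 : forall i t, domU S i t -> 0 < fU_ S i t;
  fU_probability : forall i,
    (\int[lebesgue_measure]_(t in domU S i) (fU_ S i t)%:E = 1)%E;
  measurable_bridge : forall k, (k <= nlayers S)%N ->
    measurable_fun spaceX (bridge S k);
  bridge_ge0 : forall k x, (k <= nlayers S)%N -> spaceX x -> 0 <= bridge S k x;
  bridge_mass : forall k, (k <= nlayers S)%N ->
    (0 < \int[leb d]_(x in spaceX) (bridge S k x * lam x)%:E < +oo)%E;
  bridge0_bounded : (ereal_sup [set (bridge S 0 x)%:E | x in spaceX] < +oo)%E;
  bridge_ratio_bounded : forall j k, (j < k <= nlayers S)%N ->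
    sup_ratio_finite (bridge S k) (bridge S j);
  pihat_ratio_bounded : forall k, (k <= nlayers S)%N ->
    sup_ratio_finite (bridge S k) (pihat k);
  approx_tt : forall j, (j <= nlayers S)%N ->
    tt_function (layer_dom j) (tt_approx S j);
  measurable_approx : forall j, (j <= nlayers S)%N ->
    measurable_fun (layer_dom j) (tt_approx S j);
  approx_L2 : forall j, (j <= nlayers S)%N ->
    (L2norm (layer_dom j) (layer_wgt j) (tt_approx S j) < +oo)%E;
  gam_gt0 : forall j, (j <= nlayers S)%N -> 0 < gam S j;
  refmap_invP : inverse_up_to_null spaceU unit_cube refmap (refmap_inv S);
  transportP : forall j, (j <= nlayers S)%N ->
    inverse_rosenblatt (layer_dom j) (layer_density j) (transport S j)
}.

End dirt_definitions.

(* Main.v *)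
(* Every layer map of the DIRT is the composition of the map of marginal cdfs, which
   sends mu to the uniform measure on the cube, with an almost everywhere inverse of
   a Rosenblatt map, which sends the layer density to the uniform measure.  The latter
   two facts follow by induction on the dimension from Tonelli's theorem and the
   one-dimensional probability integral transform.  Hence the layer map sends mu to
   the layer density, and a change of density p_k = (p_k / f_U) f_U carried through
   the earlier layers shows that the composition Tbar_k sends mu to the measure with
   density pihat_k lambda / zbar_k.

   Let p and q be the densities of the target and of the push-forward.  Then
   sqrt (z p) - sqrt (zbar q) is (sqrt pi_k - sqrt pihat_k) sqrt lambda, of L2 norm at
   most e, whence |sqrt p - sqrt q| has L2 norm at most 2 e / sqrt z.  This is the
   Hellinger bound; the total variation and chi^2 bounds follow by Cauchy-Schwarz from
   p - q = (sqrt p - sqrt q) (sqrt p + sqrt q). *)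

(* Most identities hold only up to null sets, and this shapes the argument. A conditional cdf has no
   meaning on a fibre of mass 0 or of infinite mass, so the induction on the dimension is run for
   unnormalised densities of mass [Z >= 0], and the fibres of infinite mass are discarded as a null
   set. The inverses of the layer maps are left inverses almost everywhere; because [f_U] is
   positive, a property that holds almost everywhere on the target of a layer map pulls back to its
   source, and in this way exceptional sets survive composition. The maps are measurable only on X,
   on U or on the cube, so a push-forward is handled through its values on measurable sets.

   The factor 2 in [2 e / sqrt z] pays for the two different normalising constants z and zbar, about
   whose difference nothing is assumed. In the chi^2 bound, lambda cancels in
   [p / q = (zbar / z) (pi_k / pihat_k)], which is the origin of the prefactor [zbar / z]. *)
From HB Require Import structures.
Require Import Defs.
From mathcomp Require Import all_boot all_order all_algebra.
From mathcomp Require Import all_classical all_reals all_analysis.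
From mathcomp Require Import measurable_realfun.
From mathcomp Require Import ring lra.

Set Implicit Arguments.
Unset Strict Implicit.
Unset Printing Implicit Defensive.
Import Order.TTheory GRing.Theory Num.Theory.
Import numFieldNormedType.Exports.
Local Open Scope classical_set_scope.
Local Open Scope ring_scope.

(** * Measures with a density *)

Section measure_with_density.
Local Open Scope ereal_scope.
Context d (T : measurableType d) (R : realType).
Variables (mu : {measure set T -> \bar R}) (p : T -> \bar R).
Hypotheses (mp : measurable_fun setT p) (p0 : forall x, 0 <= p x).

Lemma density_is_measure :
  exists m : {measure set T -> \bar R}, forall A, m A = \int[mu]_(x in A) p x.
Proof.
pose m (A : set T) := \int[mu]_(x in A) p x.
have m0 : m set0 = 0 by rewrite /m integral_set0.
have mge0 A : 0 <= m A by rewrite /m; apply: integral_ge0.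
have msa : semi_sigma_additive m.
  move=> F mF tF mUF.
  rewrite /m ge0_integral_bigcup//; last exact: measurable_funTS.
  by apply: is_cvg_ereal_nneg_natsum_cond => n _ _; exact: mge0.
pose mm := isMeasure.Build _ _ _ m m0 mge0 msa.
pose M : {measure set T -> \bar R} := HB.pack m mm.
by exists M.
Qed.

Import HBNNSimple.

Lemma ge0_integral_density (m : {measure set T -> \bar R}) (f : T -> \bar R) :
  (forall A, measurable A -> m A = \int[mu]_(x in A) p x) ->
  measurable_fun setT f -> (forall x, 0 <= f x) ->
  \int[m]_x f x = \int[mu]_x (f x * p x).
Proof.
move=> mE mf f0; pose h := nnsfun_approx measurableT mf.
have hm n : \int[m]_x (h n x)%:E = \int[mu]_x ((h n x)%:E * p x).
  have mi y : measurable_fun setT (fun x => (y * \1_(h n @^-1` [set y]) x)%:E).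
    by apply/measurable_EFinP; apply: measurable_funM => //.
  transitivity (\int[m]_x \sum_(y \in range (h n))
      (y * \1_(h n @^-1` [set y]) x)%:E).
    by apply: eq_integral => x _; rewrite fsumEFin// -fimfunE.
  transitivity (\int[mu]_x \sum_(y \in range (h n))
      ((y * \1_(h n @^-1` [set y]) x)%:E * p x)); last first.
    apply: eq_integral => x _; rewrite -ge0_mule_fsuml.
      by rewrite fsumEFin// -fimfunE.
    by move=> y; exact: nnfun_muleindic_ge0.
  rewrite ge0_integral_fsum//; last by move=> y x _; exact: nnfun_muleindic_ge0.
  rewrite ge0_integral_fsum//; last 2 first.
    by move=> y; apply: emeasurable_funM.
    by move=> y x _; rewrite mule_ge0// nnfun_muleindic_ge0.
  apply: eq_fsbigr => y /[!inE] -[x _ <-].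
  have y0 : (0 <= h n x)%R by [].
  have mA : measurable (h n @^-1` [set h n x]) by exact: measurable_funPTI.
  under eq_integral do rewrite EFinM.
  rewrite ge0_integralZl//; last by apply/measurable_EFinP.
  under [RHS]eq_integral do rewrite EFinM -muleA.
  rewrite ge0_integralZl//; last 2 first.
    by apply: emeasurable_funM => //; exact/measurable_EFinP.
    by move=> z _; rewrite mule_ge0.
  rewrite integral_indic// setIT mE// integral_mkcond; congr (_ * _).
  by apply: eq_integral => z _; rewrite patchE indicE; case: ifPn => _;
    rewrite ?mul1e ?mul0e.
have hf x : (h n x)%:E @[n --> \oo] --> f x.
  by apply: cvg_nnsfun_approx => // y _; exact: f0.
have nd_h x : nondecreasing_seq (fun n => (h n x)%:E).
  by move=> a b ab; rewrite lee_fin; exact/lefP/nd_nnsfun_approx.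
transitivity (limn (fun n => \int[m]_x (h n x)%:E)).
  rewrite -monotone_convergence//.
  - by apply: eq_integral => x _; apply/esym/cvg_lim.
  - by move=> n; exact/measurable_EFinP/measurable_funP.
  - by move=> n x _; rewrite lee_fin.
transitivity (limn (fun n => \int[mu]_x ((h n x)%:E * p x))).
  by congr (limn _); apply/funext => n.
rewrite -monotone_convergence//.
- apply: eq_integral => x _; apply/cvg_lim => //.
  (* Multiplication by a finite [p x] is continuous. For [p x = +oo] the product is constantly 0 if
     [f x = 0], as every [h n x] is then 0, and otherwise it is eventually constant, equal to
     [+oo]. *)
  have [px|px] := boolP (p x \is a fin_num); first exact: cvgeZr.
  have {px} -> : p x = +oo.
    by move: px; rewrite ge0_fin_numE// -leNgt leye_eq => /eqP.
  have [fx0|fx0] := eqVneq (f x) 0.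
    have hx n : (h n x)%:E = 0.
      apply/eqP; rewrite eq_le; apply/andP; split; last by rewrite lee_fin.
      rewrite -fx0 (cvg_unique _ (hf x) (ereal_nondecreasing_cvgn (nd_h x)))//.
      by apply: ereal_sup_ubound; exists n.
    by under eq_fun do rewrite hx mul0e; rewrite fx0 mul0e; exact: cvg_cst.
  rewrite gt0_muley ?lt0e ?fx0 ?f0//.
  have [N hN] : exists N, 0 < (h N x)%:E.
    apply: contrapT => /forallNP hx; move/eqP: fx0; apply.
    have {}hx : (fun n => (h n x)%:E) = (fun=> 0).
      apply/funext => n; apply: contrapT => /eqP hn.
      by apply: (hx n); rewrite lt0e hn/= lee_fin.
    have := hf x; rewrite hx => fx.
    by apply: (cvg_unique _ fx) => //; exact: cvg_cst.
  apply: cvg_near_cst; exists N => // n /= Nn; rewrite gt0_muley//.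
  exact: lt_le_trans hN (nd_h x _ _ Nn).
- by move=> n; apply: emeasurable_funM => //; exact/measurable_EFinP/measurable_funP.
- by move=> n x _; rewrite mule_ge0// lee_fin.
- by move=> x _ a b ab; rewrite lee_wpmul2r//; exact: nd_h.
Qed.

End measure_with_density.

(** * The probability integral transform *)

Section probability_integral_transform.
Context {R : realType}.
Local Open Scope ereal_scope.
Local Notation leb1 := (@lebesgue_measure R).

Section atomless.
Variable P : probability (measurableTypeR R) R.
Hypothesis P1 : forall t, P [set t] = 0.

Let F (t : R) : R := fine (P `]-oo, t]%classic).

Let FE t : (F t)%:E = P `]-oo, t]%classic.
Proof. by rewrite fineK// fin_num_measure. Qed.

Let F_nd : {homo F : s t / (s <= t)%R}.
Proof.
move=> s t st; rewrite -lee_fin !FE le_measure ?inE//.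
by apply: subset_itvl; rewrite bnd_simp.
Qed.

Let mF : measurable_fun setT F.
Proof. by apply: nondecreasing_measurable => // s t; exact: F_nd. Qed.

(* The sublevel set is ]-oo, b[ with b the x-quantile.  Right continuity of F gives
   x <= F b, and P ]-oo, b[ = F b because P has no atom. *)
Let F_lt (x : R) : P [set t | (F t < x)%R] = leb1 (`]-oo, x[%classic `&` `[0%R, 1%R]%classic).
Proof.
have F0 t : (0 <= F t)%R by rewrite fine_ge0.
have F1 t : (F t <= 1)%R by rewrite -lee_fin FE probability_le1.
(* The limits and the right continuity of a cdf are stated for random variables; [F] is the cdf of
   the identity under [P]. *)
pose idR : measurableTypeR R -> R := idfun.
pose X : {RV P >-> R} :=
  HB.pack idR (@isMeasurableFun.Build _ _ _ _ idR (@measurable_id _ _ setT)).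
have XE t : cdf X t = (F t)%:E by rewrite FE /cdf /distribution /pushforward.
have [x0|x0] := leP x 0%R.
  have -> : [set t | (F t < x)%R] = set0.
    by apply/seteqP; split=> t //= /lt_le_trans /(_ x0); rewrite ltNge F0.
  rewrite measure0 (_ : _ `&` _ = set0) ?measure0//.
  apply/seteqP; split=> t //=; rewrite !in_itv/= => -[tx /andP[t0 _]].
  by move: (le_lt_trans t0 tx); rewrite ltNge x0.
have xE : leb1 (`]-oo, x[%classic `&` `[0%R, 1%R]%classic) = (Num.min x 1%R)%:E.
  have [x1|x1] := leP x 1%R.
    rewrite (_ : _ `&` _ = `[0%R, x[%classic).
      by rewrite lebesgue_measure_itv/= lte_fin x0 sube0.
    apply/seteqP; split=> t /=; rewrite !in_itv/=; first by move=> [-> /andP[->]].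
    by move=> /andP[-> tx]; rewrite tx (le_trans (ltW tx)).
  rewrite (_ : _ `&` _ = `[0%R, 1%R]%classic).
    by rewrite lebesgue_measure_itv/= lte_fin ltr01 sube0.
  apply/seteqP; split=> t /=; rewrite !in_itv/=; first by move=> [].
  by move=> /andP[t0 t1]; rewrite t0 t1 (le_lt_trans t1 x1).
rewrite xE.
pose B := [set t | (x <= F t)%R].
(* The quantile [b] is the infimum of [B], so [B] has to be nonempty and bounded below. If it is
   empty, [F] stays below [x], its limit at infinity gives [1 <= x], and both sides are 1. *)
have [B0|/set0P B0] := eqVneq B set0.
  have -> : [set t | (F t < x)%R] = setT.
    apply/seteqP; split=> t //= _; rewrite ltNge; apply/negP => xt.
    by have : B t by []; rewrite B0.
  rewrite probability_setT; congr EFin; apply/esym/min_idPr.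
  rewrite leNgt; apply/negP => x1.
  have Fx t : (F t < x)%R.
    by rewrite ltNge; apply/negP => xt; have : B t by []; rewrite B0.
  have : (1 : \bar R) <= x%:E.
    apply: (cvge_le _ (cvg_cdfy1 X)).
    by apply: nearW => t; rewrite XE lee_fin ltW.
  by rewrite lee_fin leNgt x1.
have x1 : (x <= 1)%R by case: B0 => t /= xt; exact: le_trans xt (F1 t).
(* By monotonicity of [F], a superlevel set unbounded below is the whole line, and the limit 0 of
   [F] at minus infinity would contradict [0 < x]. *)
have lbB : has_lbound B.
  apply: contrapT => nB.
  have xF t : (x <= F t)%R.
    rewrite leNgt; apply/negP => Ftx; apply: nB; exists t => s /= xs.
    rewrite leNgt; apply/negP => st.
    by move: (lt_le_trans Ftx xs); rewrite ltNge F_nd// ltW.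
  have : x%:E <= 0.
    apply: (cvge_ge _ (cvg_cdfNy0 X)).
    by apply: nearW => t; rewrite XE lee_fin.
  by rewrite lee_fin leNgt x0.
pose b := inf B.
have ltb t : (t < b)%R -> (F t < x)%R.
  move=> tb; rewrite ltNge; apply/negP => xt.
  by move: tb; rewrite ltNge => /negP; apply; exact: ge_inf.
have gtb t : (b < t)%R -> (x <= F t)%R.
  move=> bt; have [s Bs st] := inf_lt B0 bt.
  by apply: (le_trans Bs); exact/F_nd/ltW.
have xFb : (x <= F b)%R.
  rewrite -lee_fin -XE.
  have cXb : cdf X t @[t --> b^'+] --> cdf X b := @cdf_right_continuous _ _ _ _ X b.
  apply: (cvge_ge _ cXb).
  near=> t; rewrite XE lee_fin gtb//; near: t; exact: nbhs_right_gt.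
have -> : [set t | (F t < x)%R] = `]-oo, b[%classic.
  apply/seteqP; split=> t /=; rewrite in_itv/=; last exact: ltb.
  by move=> Ftx; rewrite ltNge; apply/negP => /F_nd; rewrite leNgt (lt_le_trans Ftx).
have PbE : P `]-oo, b[%classic = P `]-oo, b]%classic.
  have -> : `]-oo, b]%classic = `]-oo, b[%classic `|` [set b] by rewrite setUitv1.
  rewrite measureU//; last first.
    apply/seteqP; split=> t //=.
    by rewrite in_itv/= => -[+ tb]; rewrite tb ltxx.
  by rewrite [X in _ + X]P1 adde0.
rewrite (min_idPl x1); apply/eqP; rewrite eq_le; apply/andP; split; last first.
  by rewrite PbE -FE lee_fin.
(* Each [E n] has measure [F (b - 1/(n+1)) < x], and continuity from below along their union leaves
   [P ]-oo, b[ <= x]. *)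
pose E (n : nat) := `]-oo, (b - n.+1%:R^-1)%R]%classic.
have bE : `]-oo, b[%classic = \bigcup_n E n.
  apply/seteqP; split=> t /=.
    rewrite in_itv/= => /ltr_add_invr[n tn]; exists n => //=.
    by rewrite /E/= in_itv/= lerBrDr ltW.
  move=> [n _]; rewrite /E/= !in_itv/= => /le_lt_trans; apply.
  by rewrite ltrBlDr ltrDl invr_gt0.
rewrite bE.
have ndE : nondecreasing_seq E.
  move=> i j ij; apply/subsetPset; apply: subset_itvl; rewrite bnd_simp lerB//.
  by rewrite lef_pV2 ?posrE// ler_nat.
apply: (cvge_le _ (nondecreasing_cvg_mu (mu := P) (F := E) _ _ ndE)).
- apply: nearW => n; rewrite /= -FE lee_fin ltW// ltb//.
  by rewrite ltrBlDr ltrDl invr_gt0.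
- by move=> n; exact: measurable_itv.
- by apply: bigcup_measurable => n _; exact: measurable_itv.
Unshelve. all: by end_near. Qed.

(** The open rays form a pi-system that generates the Borel sets and covers the line, and on it the
    two measures agree by [F_lt]. *)
Lemma probability_integral_transform A : measurable A ->
  P (F @^-1` A) = leb1 (A `&` `[0%R, 1%R]%classic).
Proof.
have mF' : measurable_fun setT (F : measurableTypeR R -> measurableTypeR R).
  exact: mF.
pose m1 : {measure set (measurableTypeR R) -> \bar R} :=
  measure_function_pushforward__canonical__measure_function_Measure P mF'.
pose m2 : {measure set (measurableTypeR R) -> \bar R} :=
  mrestr leb1 (measurable_itv `[0%R, 1%R]).
move=> mA; suff : m1 A = m2 A by [].
apply: (@measure_unique _ R (measurableTypeR R) (@RGenInftyO.G R)
  (fun n => `]-oo, n%:R[%classic) _ _ _ _ m1 m2 _ _ A) => //.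
- exact: RGenInftyO.measurableE.
- move=> _ _ [x ->] [y ->]; exists (Num.min x y).
  apply/seteqP; split=> t /=; rewrite !in_itv/= lt_min; first by move=> [-> ->].
  by move=> /andP[].
- by move=> n; exists n%:R.
- apply/seteqP; split=> // t _; exists (Num.truncn t).+1 => //=.
  by rewrite in_itv/= truncnS_gt.
- by move=> _ [x ->]; rewrite [RHS]/= /mrestr -F_lt /m1 /= /pushforward; congr (P _);
    apply/seteqP; split=> t; rewrite /= in_itv.
- move=> n; apply: (@le_lt_trans _ _ 1); last exact: ltry.
  apply: probability_le1; rewrite -[X in measurable X]setTI.
  exact: (mF' measurableT _ (measurable_itv _)).
Qed.

End atomless.

(** Integral form of the transform for an unnormalised density [g]. The normalised measure has no
    atoms, being absolutely continuous, so its cdf pushes it to the uniform measure. *)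
Lemma integral_cdf_transform (g psi : R -> \bar R) (Z : R) :
  measurable_fun setT g -> (forall t, 0 <= g t) ->
  \int[leb1]_t g t = Z%:E -> (0 < Z)%R ->
  measurable_fun setT psi -> (forall t, 0 <= psi t) ->
  \int[leb1]_t
    (psi (fine (\int[leb1]_(s in `]-oo, t]%classic) g s) / Z)%R * g t) =
  Z%:E * \int[leb1]_(t in `[0%R, 1%R]) psi t.
Proof.
move=> mg g0 gZ Z0 mpsi psi0.
have Z'0 : 0 <= Z^-1%:E by rewrite lee_fin invr_ge0 ltW.
pose p t := Z^-1%:E * g t.
have mp : measurable_fun setT p by apply: measurable_funeM.
have p0 t : 0 <= p t by rewrite mule_ge0.
have [m mE] := density_is_measure
  (lebesgue_measure : {measure set (measurableTypeR R) -> \bar R}) mg g0.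
(* The Dirac mass is the default of [mnormalize] for a total mass 0 or infinite; here the mass is
   [Z], positive and finite. *)
pose P : probability (measurableTypeR R) R := mnormalize m (\d_(0%R : measurableTypeR R)).
have PE A : measurable A -> P A = \int[leb1]_(t in A) p t.
  move=> mA; rewrite [LHS]/= /mnormalize mE gZ eqe gt_eqF//= mE muleC.
  by rewrite ge0_integralZl//; exact: measurable_funTS.
have P1 t : P [set t] = 0.
  rewrite PE//; apply: null_set_integral => //.
    exact: measurable_funTS.
  exact: lebesgue_measure_set1.
pose F (t : R) : R := fine (P `]-oo, t]%classic).
have FE t : (fine (\int[leb1]_(s in `]-oo, t]%classic) g s) / Z)%R = F t.
  rewrite /F PE// ge0_integralZl//; last exact: measurable_funTS.
  rewrite mulrC fineM// ge0_fin_numE ?integral_ge0//.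
  apply: (@le_lt_trans _ _ Z%:E); last exact: ltry.
  by rewrite -gZ; exact: ge0_subset_integral.
under eq_integral do rewrite FE.
have mF : measurable_fun setT F.
  apply: nondecreasing_measurable => // s t st.
  rewrite fine_le ?fin_num_measure// le_measure ?inE//.
  by apply: subset_itvl; rewrite bnd_simp.
have mF' : measurable_fun setT (F : measurableTypeR R -> measurableTypeR R).
  exact: mF.
transitivity (Z%:E * \int[P]_t psi (F t)).
  have mpsiF : measurable_fun setT (psi \o F) by exact: measurableT_comp.
  rewrite (@ge0_integral_density _ (measurableTypeR R) R lebesgue_measure p mp p0
    P (psi \o F) PE mpsiF (fun t => psi0 (F t))).
  have mpsiFp : measurable_fun setT ((psi \o F) \* p) by exact: emeasurable_funM.
  rewrite -(ge0_integralZl lebesgue_measure measurableT mpsiFp)//; last 2 first.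
  - by move=> t _; rewrite mule_ge0//=.
  - by rewrite lee_fin ltW.
  apply: eq_integral => t _; rewrite /p [RHS]muleCA/=; congr (_ * _).
  by rewrite muleA -EFinM divff ?gt_eqF// mul1e.
congr (_ * _).
have := @ge0_integral_pushforward _ _ _ _ _ _ mF' P setT psi measurableT mpsi (fun t _ => psi0 t).
rewrite preimage_setT => <-.
transitivity (\int[mrestr leb1 (measurable_itv `[0%R, 1%R])]_t psi t).
  apply: eq_measure_integral => A mA _.
  exact: (probability_integral_transform P1 mA).
pose i01 (t : R) : \bar R := (\1_(`[0%R, 1%R]%classic : set R) t)%:E.
have mi : measurable_fun setT i01 by exact/measurable_EFinP.
have i0 t : 0 <= i01 t by rewrite lee_fin.
have iE A : measurable A ->
    mrestr leb1 (measurable_itv `[0%R, 1%R]) A = \int[leb1]_(t in A) i01 t.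
  by move=> mA; rewrite integral_indic// setIC.
rewrite (@ge0_integral_density _ (measurableTypeR R) R lebesgue_measure i01 mi i0
  (mrestr leb1 (measurable_itv `[0%R, 1%R])) psi iE mpsi psi0) [RHS]integral_mkcond.
apply: eq_integral => t _.
by rewrite patchE /i01 indicE; case: ifPn; rewrite ?mule1 ?mule0.
Qed.
End probability_integral_transform.

(** * Lebesgue measure on tuples and triangular maps *)

Section lebesgue_tuple.
Context {R : realType}.
Local Open Scope ereal_scope.
Local Notation leb1 := (@lebesgue_measure R).
Implicit Types n : nat.

Lemma integral_leb0 (f : 0.-tuple R -> \bar R) :
  measurable_fun setT f -> \int[leb 0]_x f x = f [tuple].
Proof.
move=> mf; rewrite (eq_measure_integral \d_([tuple] : 0.-tuple R))//.
by rewrite integral_dirac// diracT mul1e.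
Qed.

Lemma ge0_integral_leb_cons n (f : n.+1.-tuple R -> \bar R) :
  measurable_fun setT f -> (forall x, 0 <= f x) ->
  \int[leb n.+1]_x f x = \int[leb1]_t \int[leb n]_y f (tuple_cons (t, y)).
Proof.
move=> mf f0.
pose m : {measure set _ -> \bar R} :=
  measure_function_pushforward__canonical__measure_function_Measure
    (leb1 \x leb n)%E (@measurable_tuple_cons R n).
rewrite (eq_measure_integral m)//.
rewrite ge0_integral_pushforward//.
  rewrite preimage_setT (@fubini_tonelli1 _ _ (measurableTypeR R) _ R leb1 (leb n))//=.
  by apply: measurableT_comp => //; exact: measurable_tuple_cons.
exact: measurable_tuple_cons.
Qed.

Lemma measurable_integral_leb_cons n (f : n.+1.-tuple R -> \bar R) :
  measurable_fun setT f -> (forall x, 0 <= f x) ->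
  measurable_fun setT (fun t => \int[leb n]_y f (tuple_cons (t, y))).
Proof.
move=> mf f0.
have := @measurable_fun_fubini_tonelli_F _ _ (measurableTypeR R) _ R (leb n)
  (fun z => f (tuple_cons z)).
apply=> //; apply: measurableT_comp => //; exact: measurable_tuple_cons.
Qed.

Lemma measurable_tuple_cons2 n (t : R) :
  measurable_fun setT (fun y : n.-tuple R => tuple_cons (t, y)).
Proof.
apply: (@measurable_cons _ _ _ _ (fun=> t) n id); first exact: measurable_cst.
exact: measurable_id.
Qed.

Lemma measurable_unit_cube n : measurable (@unit_cube R n).
Proof.
rewrite (_ : unit_cube = \bigcap_(i in [set: 'I_n])
    (@tnth n R ^~ i) @^-1` `[0%R, 1%R]%classic).
  apply: fin_bigcap_measurable => // i _.
  rewrite -[X in measurable X]setTI.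
  by apply: measurable_tnth => //; exact: measurable_itv.
by apply/seteqP; split=> [x Hx i _|x Hx i]; [exact: Hx|exact: (Hx i I)].
Qed.

Lemma tnth_cons0 n (t : R) (y : n.-tuple R) : tnth (tuple_cons (t, y)) ord0 = t.
Proof. by []. Qed.

Lemma tnth_consS n (t : R) (y : n.-tuple R) i :
  tnth (tuple_cons (t, y)) (lift ord0 i) = tnth y i.
Proof. exact: tnthS. Qed.

Lemma unit_cube_cons n (t : R) (y : n.-tuple R) :
  unit_cube (tuple_cons (t, y)) = (`[0%R, 1%R]%classic t /\ unit_cube y).
Proof.
apply/propext; split=> [H|[t01 Hy] i].
  by split; [exact: (H ord0)|move=> i; have := H (lift ord0 i); rewrite tnth_consS].
by case: (unliftP ord0 i) => [j ->|->//]; rewrite tnth_consS.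
Qed.

Lemma integral_unit_cube_cons n (f : n.+1.-tuple R -> \bar R) :
  measurable_fun setT f -> (forall x, 0 <= f x) ->
  \int[leb n.+1]_(x in unit_cube) f x =
  \int[leb1]_(t in `[0%R, 1%R]) \int[leb n]_(y in unit_cube) f (tuple_cons (t, y)).
Proof.
move=> mf f0; rewrite integral_mkcond ge0_integral_leb_cons; last 2 first.
- exact: (measurable_restrictT f (@measurable_unit_cube n.+1)).1 (measurable_funTS mf).
- by move=> x; rewrite erestrict_ge0.
rewrite [RHS]integral_mkcond; apply: eq_integral => t _.
rewrite patchE; case: ifPn => t01.
  rewrite [RHS]integral_mkcond; apply: eq_integral => y _.
  rewrite !patchE; congr (if _ then _ else _).
  by apply/idP/idP; rewrite !inE unit_cube_cons; [case|split=> //; rewrite -inE].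
rewrite integral0_eq// => y _; rewrite patchE; case: ifPn => //.
by rewrite inE unit_cube_cons => -[]; rewrite -inE (negbTE t01).
Qed.

End lebesgue_tuple.

Section triangular_maps.
Context {R : realType}.
Local Open Scope ereal_scope.
Local Notation leb1 := (@lebesgue_measure R).
Implicit Types n : nat.

(* The induction step on the dimension, shared by Rosenblatt maps and maps of
   marginal cdfs. *)
Lemma triangular_pushforward n (p : n.+1.-tuple R -> \bar R)
    (F : n.+1.-tuple R -> n.+1.-tuple R) (H : R -> n.-tuple R -> n.-tuple R)
    (Z : R) (phi : n.+1.-tuple R -> \bar R) :
  let g t := \int[leb n]_y p (tuple_cons (t, y)) in
  measurable_fun setT p -> (forall x, 0 <= p x) -> measurable_fun setT F ->
  \int[leb1]_t g t = Z%:E -> (0 < Z)%R ->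
  (forall t y, F (tuple_cons (t, y)) =
    tuple_cons ((fine (\int[leb1]_(s in `]-oo, t]%classic) g s) / Z)%R, H t y)) ->
  (forall t, g t < +oo -> forall psi : n.-tuple R -> \bar R,
    measurable_fun setT psi -> (forall y, 0 <= psi y) ->
    \int[leb n]_y (psi (H t y) * p (tuple_cons (t, y))) =
    g t * \int[leb n]_(y in unit_cube) psi y) ->
  measurable_fun setT phi -> (forall x, 0 <= phi x) ->
  \int[leb n.+1]_x (phi (F x) * p x) =
  Z%:E * \int[leb n.+1]_(x in unit_cube) phi x.
Proof.
move=> g mp p0 mF gZ Z0 FE IH mphi phi0.
have mg : measurable_fun setT g by exact: measurable_integral_leb_cons.
have g0 t : 0 <= g t by exact: integral_ge0.
pose psi t := \int[leb n]_(y in unit_cube) phi (tuple_cons (t, y)).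
have mpsi : measurable_fun setT psi.
  (* With the indicator of the cube moved into the integrand, [psi] becomes a fibre integral over
     the whole space, to which [measurable_integral_leb_cons] applies. *)
  pose phi' x := phi x * (\1_unit_cube ([tuple of behead x] : n.-tuple R))%:E.
  rewrite (_ : psi = fun t => \int[leb n]_y phi' (tuple_cons (t, y))).
    apply: measurable_integral_leb_cons.
      apply: emeasurable_funM => //; apply/measurable_EFinP.
      apply: measurableT_comp.
        by apply: measurable_indic; exact: measurable_unit_cube.
      exact: measurable_behead.
    by move=> x; rewrite mule_ge0// lee_fin.
  apply/funext => t; rewrite /psi integral_mkcond; apply: eq_integral => y _.
  have by_ : [tuple of behead (tuple_cons (t, y))] = y :> n.-tuple R.
    exact: val_inj.
  by rewrite /phi' patchE indicE by_; case: ifPn => _; rewrite ?mule1 ?mule0.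
have psi0 t : 0 <= psi t by exact: integral_ge0.
have mphiF : measurable_fun setT (phi \o F) by exact: measurableT_comp.
have mphiFp : measurable_fun setT ((phi \o F) \* p) by exact: emeasurable_funM.
have phiFp0 x : 0 <= ((phi \o F) \* p) x by rewrite mule_ge0//=.
rewrite (ge0_integral_leb_cons mphiFp phiFp0) integral_unit_cube_cons//.
rewrite -(integral_cdf_transform mg g0 gZ Z0 mpsi psi0).
apply: ge0_ae_eq_integral => //.
- exact: (measurable_integral_leb_cons mphiFp phiFp0).
- apply: emeasurable_funM => //; apply: measurableT_comp => //.
  apply: nondecreasing_measurable => // s t st.
  have Gfin r : \int[leb1]_(s in `]-oo, r]%classic) g s \is a fin_num.
    rewrite ge0_fin_numE ?integral_ge0//.
    apply: (@le_lt_trans _ _ Z%:E); last exact: ltry.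
    by rewrite -gZ; exact: ge0_subset_integral.
  rewrite ler_pM2r ?invr_gt0// fine_le//.
  apply: ge0_subset_integral => //; first exact: measurable_funTS.
  by apply: subset_itvl; rewrite bnd_simp.
- by move=> t _; exact: integral_ge0.
- by move=> t _; rewrite mule_ge0.
(* Since [g] has the finite integral [Z], it is finite at almost every [t]; these are the fibres on
   which [IH] is available. *)
have : leb1.-integrable setT g.
  apply/integrableP; split => //.
  by under eq_integral do rewrite gee0_abs//; rewrite gZ ltry.
move=> /integrable_ae-/(_ measurableT); apply: filterS => t /(_ I) gfin _.
under eq_integral do rewrite /= FE.
rewrite (IH t _ (fun y => phi (tuple_cons (_, y))))//.
- by rewrite muleC.
- by rewrite -ge0_fin_numE.
- apply: measurableT_comp => //; exact: measurable_tuple_cons2.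
Qed.

Lemma splice_cons n (t : R) (y : n.-tuple R) (i : nat) (z : seq R) :
  splice i.+1 (tuple_cons (t, y)) z = tuple_cons (t, splice i y z).
Proof.
apply: eq_from_tnth => j; rewrite tnth_mktuple.
case: (unliftP ord0 j) => [k ->|->//].
by rewrite !tnth_consS tnth_mktuple.
Qed.

Lemma splice0 n (x : n.-tuple R) (z : n.-tuple R) : splice 0 x z = z.
Proof. by apply: eq_from_tnth => j; rewrite tnth_mktuple/= subn0 (tnth_nth 0%R). Qed.

Lemma measurable_splice n (i : nat) : (i <= n)%N ->
  measurable_fun setT
    (fun xz : n.-tuple R * (n - i).-tuple R => splice i xz.1 xz.2).
Proof.
move=> lein; apply/measurable_fun_tnthP => j.
have [ji|ij] := ltnP j i.
  rewrite (_ : _ \o _ = (@tnth n R ^~ j) \o fst).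
    by apply: measurableT_comp => //; exact: measurable_tnth.
  by apply/funext => xz /=; rewrite tnth_mktuple ji.
have jin : (j - i < n - i)%N by rewrite ltn_sub2r// (leq_ltn_trans ij).
rewrite (_ : _ \o _ = (@tnth (n - i) R ^~ (Ordinal jin)) \o snd).
  by apply: measurableT_comp => //; exact: measurable_tnth.
by apply/funext => xz /=; rewrite tnth_mktuple ltnNge ij/= (tnth_nth 0%R).
Qed.

(** Every conditional cdf after the first keeps [t] fixed in both numerator and denominator. Being a
    quotient, it is the same for the section of [p] at [t] as for the normalised section. *)
Lemma rosenblatt_cons n (p : n.+1.-tuple R -> R) (t : R) (y : n.-tuple R) :
  rosenblatt setT p (tuple_cons (t, y)) =
  tuple_cons (cond_cdf setT p ord0 (tuple_cons (t, y)),
    rosenblatt setT (fun y' => p (tuple_cons (t, y'))) y).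
Proof.
apply: eq_from_tnth => j; rewrite tnth_mktuple.
case: (unliftP ord0 j) => [k ->|->//].
rewrite !tnth_consS tnth_mktuple /cond_cdf tnth_consS.
congr (_ / _)%R.
  (* A restatement up to conversion: the dimension [n.+1 - lift ord0 k] computes to [n - k], and
     [splice k.+1] becomes visible to [splice_cons]. *)
  transitivity (\int[leb (n - k)]_(z in [set z | [set: n.+1.-tuple R]
    (splice k.+1 (tuple_cons (t, y)) z) /\
      (nth 0 z 0%N <= tnth y k)%R]) p (splice k.+1 (tuple_cons (t, y)) z))%R.
    by [].
  by under eq_Rintegral do rewrite splice_cons.
transitivity (\int[leb (n - k)]_(z in [set z | [set: n.+1.-tuple R]
    (splice k.+1 (tuple_cons (t, y)) z)]) p (splice k.+1 (tuple_cons (t, y)) z))%R.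
  by [].
by under eq_Rintegral do rewrite splice_cons.
Qed.

(** No coordinate precedes the first, so [splice] discards [x], and Tonelli turns the condition on
    the head of [z] into the range of the outer integral. *)
Lemma cond_cdf_head n (p : n.+1.-tuple R -> R) (t : R) (y : n.-tuple R) :
  measurable_fun setT p -> (forall x, (0 <= p x)%R) ->
  let g s := \int[leb n]_y (p (tuple_cons (s, y)))%:E in
  cond_cdf setT p ord0 (tuple_cons (t, y)) =
  (fine (\int[leb1]_(s in `]-oo, t]%classic) g s) / fine (\int[leb1]_s g s))%R.
Proof.
move=> mp p0 g.
have mp' : measurable_fun setT (EFin \o p) by exact/measurable_EFinP.
have p0' x : 0 <= (EFin \o p) x by rewrite lee_fin.
rewrite /cond_cdf; congr (_ / _)%R.
  transitivity (\int[leb n.+1]_(z in [set z : n.+1.-tuple R | [set: n.+1.-tuple R]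
    (splice 0 (tuple_cons (t, y)) z) /\
      (nth 0 z 0%N <= t)%R]) p (splice 0 (tuple_cons (t, y)) z))%R.
    by [].
  under eq_Rintegral do rewrite splice0.
  rewrite /Rintegral; congr fine.
  set A := [set z | _].
  have mA : measurable A.
    rewrite (_ : A = (@tnth n.+1 R ^~ ord0) @^-1` `]-oo, t]%classic).
      rewrite -[X in measurable X]setTI.
      by apply: measurable_tnth => //; exact: measurable_itv.
    apply/seteqP; split => z; rewrite /A/= in_itv/= (tnth_nth 0%R)//=.
    by case.
  rewrite integral_mkcond ge0_integral_leb_cons; last 2 first.
  - exact: (measurable_restrictT (EFin \o p) mA).1 (measurable_funTS mp').
  - by move=> x; apply: erestrict_ge0 => z _; rewrite lee_fin.
  rewrite [RHS]integral_mkcond; apply: eq_integral => s _.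
  rewrite patchE; case: ifPn => st.
    rewrite /g; apply: eq_integral => z _; rewrite patchE ifT// inE /A/=.
    by split => //; move: st; rewrite inE/= in_itv.
  rewrite integral0_eq// => z _; rewrite patchE ifF//.
  apply/negbTE; move: st; apply: contra; rewrite !inE/= in_itv/= /A/=.
  by move=> [].
transitivity (\int[leb n.+1]_(z in [set z : n.+1.-tuple R | [set: n.+1.-tuple R]
    (splice 0 (tuple_cons (t, y)) z)]) p (splice 0 (tuple_cons (t, y)) z))%R.
  by [].
under eq_Rintegral do rewrite splice0.
rewrite /Rintegral; congr fine.
rewrite (_ : [set z | _] = setT); last by apply/seteqP; split.
by rewrite ge0_integral_leb_cons.
Qed.

(** The real power agrees with the inverse on nonnegative reals only, whence [1/f = f * (f^2)^(-1)];
    where [f] vanishes, both sides are 0. *)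
Lemma measurable_invr d (T : measurableType d) (D : set T) (f : T -> R) :
  measurable_fun D f -> measurable_fun D (fun x => (f x)^-1)%R.
Proof.
move=> mf.
rewrite (_ : (fun x => _) = (fun x => f x * (f x * f x) `^ (-1))%R).
  apply: measurable_funM => //; apply: (measurableT_comp (@measurable_powR R (-1))).
  exact: (measurable_funM mf mf).
apply/funext => x; rewrite powR_inv1 -?expr2 ?sqr_ge0//.
have [->|fx0] := eqVneq (f x) 0%R; first by rewrite invr0 mul0r.
by rewrite expr2 invfM mulrA divff// mul1r.
Qed.

Lemma measurable_rosenblatt n (p : n.-tuple R -> R) :
  measurable_fun setT p -> (forall x, (0 <= p x)%R) ->
  measurable_fun setT (rosenblatt setT p).
Proof.
move=> mp p0; apply/measurable_fun_tnthP => i.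
rewrite (_ : _ \o _ = cond_cdf setT p i); last first.
  by apply/funext => x /=; rewrite tnth_mktuple.
pose ni := (n - i)%N.
have mps : measurable_fun setT
    (fun xz : n.-tuple R * ni.-tuple R => p (splice i xz.1 xz.2)).
  exact: (measurableT_comp mp (measurable_splice (ltnW (ltn_ord i)))).
have ni0 : (0 < ni)%N by rewrite subn_gt0.
pose i0 : 'I_ni := Ordinal ni0.
pose c (xz : n.-tuple R * ni.-tuple R) := (tnth xz.2 i0 <= tnth xz.1 i)%R.
have mc : measurable_fun setT c.
  apply: measurable_fun_ler.
    exact: (measurableT_comp (measurable_tnth i0) measurable_snd).
  exact: (measurableT_comp (measurable_tnth i) measurable_fst).
pose f1 (xz : n.-tuple R * ni.-tuple R) : \bar R := (p (splice i xz.1 xz.2))%:E.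
(* In the numerator the domain of integration varies with [x]. As part of the integrand, the
   constraint is measurable in [x] and [z] jointly, and Tonelli gives measurability in [x]. *)
pose f2 (xz : n.-tuple R * ni.-tuple R) : \bar R := if c xz then f1 xz else 0.
have mf1 : measurable_fun setT f1 by exact/measurable_EFinP.
have mf2 : measurable_fun setT f2 by exact: measurable_fun_ifT.
have f10 xz : 0 <= f1 xz by rewrite lee_fin.
have f20 xz : 0 <= f2 xz by rewrite /f2; case: ifP.
have M1 := @measurable_fun_fubini_tonelli_F _ _ _ _ R (leb ni) f1 mf1 f10.
have M2 := @measurable_fun_fubini_tonelli_F _ _ _ _ R (leb ni) f2 mf2 f20.
rewrite (_ : cond_cdf _ _ _ = fun x => (fine (\int[leb ni]_z f2 (x, z)) /
    fine (\int[leb ni]_z f1 (x, z)))%R); last first.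
  apply/funext => x; rewrite /cond_cdf; congr (_ / _)%R; rewrite /Rintegral.
    congr fine; rewrite integral_mkcond; apply: eq_integral => z _.
    rewrite patchE /f2 /c /= (tnth_nth 0%R z)/=; congr (if _ then _ else _).
    by apply/idP/idP; rewrite inE/=; [case|split].
apply: measurable_funM.
  exact: measurableT_comp M2.
exact/measurable_invr/measurableT_comp.
Qed.

Lemma ge0_integralM_eq0 d (T : measurableType d) (mu : {measure set T -> \bar R})
    (f p : T -> \bar R) :
  measurable_fun setT f -> measurable_fun setT p ->
  (forall x, 0 <= f x) -> (forall x, 0 <= p x) ->
  \int[mu]_x p x = 0 -> \int[mu]_x (f x * p x) = 0.
Proof.
move=> mf mp f0 p0 ip0.
have aep : ae_eq mu setT p (cst 0).
  by apply/ae_eq_integral_abs => //; under eq_integral do rewrite gee0_abs//.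
rewrite (ge0_ae_eq_integral (g := cst 0))// ?integral0//.
- exact: emeasurable_funM.
- by move=> x _; rewrite mule_ge0.
- by apply: filterS aep => x /(_ I) px _; rewrite px mule0.
Qed.

Lemma leb_unit_cube n : leb n (@unit_cube R n) = 1.
Proof.
have mc n' := @measurable_unit_cube R n'.
have intE n' : leb n' (@unit_cube R n') = \int[leb n']_(x in unit_cube) (cst 1%:E x).
  by rewrite integral_cst; [rewrite mul1e|exact: mc].
elim: n => [|n IH]; rewrite intE.
  rewrite integral_mkcond integral_leb0; last first.
    by apply: (measurable_restrictT (cst 1%:E) (mc 0%N)).1.
  by rewrite patchE ifT// inE => -[].
rewrite integral_unit_cube_cons//.
transitivity (\int[leb1]_(t in `[0%R, 1%R]) (cst 1%:E t)).
  by apply: eq_integral => t _; rewrite /= -[RHS]IH intE.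
rewrite integral_cst; last exact: measurable_itv.
rewrite mul1e.
by rewrite [LHS]lebesgue_measure_itv/= lte_fin ltr01 sube0.
Qed.

(** The mass [Z] is arbitrary because the induction hypothesis is applied to the sections of [p],
    whose masses vary with [t] and may vanish. *)
Lemma rosenblatt_pushforward n (p : n.-tuple R -> R) (Z : R)
    (phi : n.-tuple R -> \bar R) :
  measurable_fun setT p -> (forall x, (0 <= p x)%R) ->
  \int[leb n]_x (p x)%:E = Z%:E ->
  measurable_fun setT phi -> (forall x, 0 <= phi x) ->
  \int[leb n]_x (phi (rosenblatt setT p x) * (p x)%:E) =
  Z%:E * \int[leb n]_(x in unit_cube) phi x.
Proof.
elim: n p Z phi => [|n IH] p Z phi mp p0 pZ mphi phi0.
  have mpE : measurable_fun setT (EFin \o p) by exact/measurable_EFinP.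
  have phiE x : phi (rosenblatt setT p x) = phi [tuple].
    by rewrite tuple0.
  under eq_integral do rewrite phiE.
  rewrite ge0_integralZl// ?pZ 1?muleC//; last by move=> x _; rewrite lee_fin.
  congr (_ * _); rewrite integral_mkcond integral_leb0.
    by rewrite patchE ifT// inE => -[].
  exact: (measurable_restrictT phi (@measurable_unit_cube _ 0%N)).1 (measurable_funTS mphi).
have mpE : measurable_fun setT (EFin \o p) by exact/measurable_EFinP.
have pE0 x : 0 <= (EFin \o p) x by rewrite lee_fin.
have Z0 : (0 <= Z)%R by rewrite -lee_fin -pZ; apply: integral_ge0 => x _; exact: pE0.
have mros := measurable_rosenblatt mp p0.
have mpt t : measurable_fun setT (fun y : n.-tuple R => p (tuple_cons (t, y))).
  exact: (measurableT_comp mp (measurable_tuple_cons2 t)).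
(* If [Z = 0], the density vanishes almost everywhere and both sides are 0, whatever default values
   the quotients in the Rosenblatt map take. *)
have [Z_eq0|Z_neq0] := eqVneq Z 0%R.
  rewrite Z_eq0 mul0e; apply: ge0_integralM_eq0 => //.
    exact: measurableT_comp.
  by rewrite pZ Z_eq0.
rewrite ge0_integral_leb_cons// in pZ.
apply: (triangular_pushforward (p := EFin \o p)
  (H := fun t => rosenblatt setT (fun y => p (tuple_cons (t, y))))) => //.
- by rewrite lt0r Z_neq0.
- by move=> t y; rewrite rosenblatt_cons cond_cdf_head//= pZ.
- move=> t gt psi mpsi psi0 /=.
  have gfin : \int[leb n]_y (p (tuple_cons (t, y)))%:E \is a fin_num.
    by rewrite ge0_fin_numE//; apply: integral_ge0 => y _; rewrite lee_fin.
  by rewrite (IH _ (fine (\int[leb n]_y (p (tuple_cons (t, y)))%:E))) ?fineK.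
Qed.

Lemma measurable_prod_tnth n (f : 'I_n -> R -> R) :
  (forall i, measurable_fun setT (f i)) ->
  measurable_fun setT (fun x : n.-tuple R => \prod_(i < n) f i (tnth x i))%R.
Proof.
move=> mf; apply: measurable_prod => i _.
exact: (measurableT_comp (mf i) (measurable_tnth i)).
Qed.

Lemma measurable_cdf (f : R -> R) (Z : R) :
  measurable_fun setT f -> (forall t, (0 <= f t)%R) ->
  \int[leb1]_t (f t)%:E = Z%:E ->
  measurable_fun setT (fun t : R => \int[leb1]_(s in `]-oo, t]%classic) f s)%R.
Proof.
move=> mf f0 fZ.
have mfE : measurable_fun setT (EFin \o f) by exact/measurable_EFinP.
have fin t : \int[leb1]_(s in `]-oo, t]%classic) (f s)%:E \is a fin_num.
  rewrite ge0_fin_numE; last by apply: integral_ge0 => s _; rewrite lee_fin.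
  apply: (@le_lt_trans _ _ Z%:E); last exact: ltry.
  by rewrite -fZ; apply: ge0_subset_integral => // s _; rewrite lee_fin.
apply: nondecreasing_measurable => // s t st; rewrite fine_le//.
apply: ge0_subset_integral => //; first exact: measurable_funTS.
- by move=> r _; rewrite lee_fin.
- by apply: subset_itvl; rewrite bnd_simp.
Qed.

Lemma cdf_product_pushforward n (f : 'I_n -> R -> R) (phi : n.-tuple R -> \bar R) :
  (forall i, measurable_fun setT (f i)) -> (forall i t, (0 <= f i t)%R) ->
  (forall i, \int[leb1]_t (f i t)%:E = 1) ->
  measurable_fun setT phi -> (forall x, 0 <= phi x) ->
  \int[leb n]_x
    (phi [tuple \int[leb1]_(t in `]-oo, tnth x i]%classic) f i t | i < n]%R *
     (\prod_(i < n) f i (tnth x i))%:E) =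
  \int[leb n]_(x in unit_cube) phi x.
Proof.
elim: n f phi => [|n IH] f phi mf f0 f1 mphi phi0.
  under eq_integral do rewrite big_ord0 mule1 tuple0.
  rewrite [RHS]integral_mkcond !integral_leb0//.
    by rewrite patchE ifT// inE => -[].
  exact: (measurable_restrictT phi (@measurable_unit_cube _ 0%N)).1 (measurable_funTS mphi).
have prod0 m (h : 'I_m -> R -> R) (x : m.-tuple R) : (forall i t, 0 <= h i t)%R ->
    (0 <= \prod_(i < m) h i (tnth x i))%R.
  by move=> h0; apply: prodr_ge0.
pose q (y : n.-tuple R) := (\prod_(i < n) f (lift ord0 i) (tnth y i))%R.
have mq : measurable_fun setT q.
  exact: (@measurable_prod_tnth _ (fun i => f (lift ord0 i))).
have mqE : measurable_fun setT (EFin \o q) by exact/measurable_EFinP.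
have q0 y : 0 <= (EFin \o q) y.
  by rewrite lee_fin; exact: (prod0 _ (fun i => f (lift ord0 i)) y (fun i => f0 _)).
pose Q (y : n.-tuple R) :=
  [tuple \int[leb1]_(t in `]-oo, tnth y i]%classic) f (lift ord0 i) t | i < n]%R.
have IHq psi : measurable_fun setT psi -> (forall y, 0 <= psi y) ->
    \int[leb n]_y (psi (Q y) * (q y)%:E) = \int[leb n]_(y in unit_cube) psi y.
  by move=> mpsi psi0; exact: IH.
(* The induction hypothesis at the constant 1 gives the mass of the remaining factors. The first
   marginal is therefore [f ord0], and [Z = 1]. *)
have q1 : \int[leb n]_y (q y)%:E = 1.
  have := IHq (cst 1%:E) (@measurable_cst _ _ _ _ _ _) (fun=> lee01).
  under eq_integral do rewrite /cst mul1e.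
  move=> ->; rewrite integral_cst; last exact: measurable_unit_cube.
  by rewrite mul1e; exact: leb_unit_cube.
pose p (x : n.+1.-tuple R) := (\prod_(i < n.+1) f i (tnth x i))%:E.
have pE t y : p (tuple_cons (t, y)) = (f ord0 t)%:E * (q y)%:E.
  rewrite /p big_ord_recl tnth_cons0 -EFinM; congr (_ * _)%:E.
  by apply: eq_bigr => i _; rewrite tnth_consS.
have gE t : \int[leb n]_y p (tuple_cons (t, y)) = (f ord0 t)%:E.
  under eq_integral do rewrite pE.
  rewrite ge0_integralZl ?lee_fin//; last by move=> y _; exact: q0.
  by rewrite [X in _ * X]q1 mule1.
rewrite -[RHS]mul1e.
apply: (triangular_pushforward (p := p) (H := fun=> Q)
  (F := fun x => [tuple \int[leb1]_(t in `]-oo, tnth x i]%classic) f i t | i < n.+1]%R)) => //.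
- by apply/measurable_EFinP; exact: (@measurable_prod_tnth _ f mf).
- by move=> x; rewrite lee_fin; exact: (prod0 _ f x f0).
- apply/measurable_fun_tnthP => i.
  rewrite (_ : _ \o _ = (fun t : R => \int[leb1]_(s in `]-oo, t]%classic) f i s)%R \o
      (@tnth n.+1 R ^~ i)).
    by apply: measurableT_comp (measurable_tnth i); exact: measurable_cdf (f1 i).
  by apply/funext => x /=; rewrite tnth_mktuple.
- by under eq_integral do rewrite gE.
- move=> t y; apply: eq_from_tnth => i; rewrite tnth_mktuple.
  case: (unliftP ord0 i) => [j ->|->].
    by rewrite !tnth_consS tnth_mktuple.
  rewrite !tnth_cons0 divr1 /Rintegral; congr fine.
  by apply: eq_integral => s _; rewrite gE.
- move=> t _ psi mpsi psi0; rewrite gE -IHq//.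
  under eq_integral do rewrite pE muleCA.
  rewrite ge0_integralZl ?lee_fin//.
  + apply: emeasurable_funM => //; apply: measurableT_comp => //.
    apply/measurable_fun_tnthP => i.
    rewrite (_ : _ \o _ = (fun t : R => \int[leb1]_(s in `]-oo, t]%classic) f (lift ord0 i) s)%R \o
        (@tnth n R ^~ i)).
      by apply: measurableT_comp (measurable_tnth i); exact: measurable_cdf (f1 _).
    by apply/funext => x /=; rewrite tnth_mktuple.
  + by move=> y _; exact: (mule_ge0 (psi0 _) (q0 _)).
Qed.

End triangular_maps.

(** * Transport of densities *)

Section transports.
Context {R : realType} {d : nat}.
Local Open Scope ereal_scope.
Implicit Types (A B C : set (d.-tuple R)) (p q r : d.-tuple R -> R).
Implicit Types (F G T : d.-tuple R -> d.-tuple R).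

(* T pushes the density p on A to the density q on B; nothing is required of T off
   A, where the maps of a DIRT need not be measurable. *)
Definition transports A B p q T : Prop :=
  [/\ measurable_fun A T, (forall x, A x -> B (T x)) &
      forall phi : d.-tuple R -> \bar R,
        measurable_fun B phi -> (forall x, B x -> 0 <= phi x) ->
        \int[leb d]_(x in A) (phi (T x) * (p x)%:E) =
        \int[leb d]_(x in B) (phi x * (q x)%:E)].

Lemma measurable_comp_in d1 d2 d3 (T1 : measurableType d1)
    (T2 : measurableType d2) (T3 : measurableType d3)
    (E : set T1) (D : set T2) (g : T1 -> T2) (f : T2 -> T3) :
  measurable D -> measurable_fun D f -> measurable_fun E g ->
  (forall x, E x -> D (g x)) -> measurable_fun E (f \o g).
Proof.
by move=> mD mf mg EgD; apply: (measurable_comp mD) => // _ [x Ex <-]; exact: EgD.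
Qed.

Lemma transports_comp A B C p q r T1 T2 :
  measurable B -> measurable C ->
  transports A B p q T1 -> transports B C q r T2 ->
  transports A C p r (T2 \o T1).
Proof.
move=> mB mC [mT1 T1B E1] [mT2 T2C E2]; split.
- exact: (measurable_comp_in mB).
- by move=> x /T1B /T2C.
move=> phi mphi phi0; rewrite -E2//.
rewrite -(E1 (phi \o T2))//; last by move=> x /T2C /phi0.
exact: (measurable_comp_in mC).
Qed.

(** Transporting [phi \o G] by [F] gives the integral of [phi (G (F x))] against [p], and
    [G (F x) = x] almost everywhere on [A]. *)
Lemma transports_inverse A B p q F G :
  measurable A -> measurable B -> measurable_fun A p ->
  (forall x, A x -> (0 <= p x)%R) ->
  transports A B p q F -> inverse_up_to_null A B F G -> transports B A q p G.
Proof.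
move=> mA mB mp p0 [mF FB E] [mG GA GFK _]; split => // phi mphi phi0.
have mphiG : measurable_fun B (phi \o G) by exact: (measurable_comp_in mA).
rewrite -(E (phi \o G))//; last by move=> x /GA /phi0.
have mpE : measurable_fun A (EFin \o p) by exact/measurable_EFinP.
apply: ge0_ae_eq_integral => //.
- by apply: emeasurable_funM => //; exact: (measurable_comp_in mB).
- exact: emeasurable_funM.
- by move=> x Ax; rewrite mule_ge0 ?lee_fin ?p0//=; exact/phi0/GA/FB.
- by move=> x Ax; rewrite mule_ge0 ?lee_fin ?p0//; exact: phi0.
- by apply: filterS GFK => x + Ax => /(_ Ax) /= ->.
Qed.

(** For a null set [N], the indicator of [N] at [T x] has integral 0 against [p], since its
    transport is the integral of [q] over a null set. As [p] is positive, [T x] avoids [N] almost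
    everywhere. This carries exceptional sets back through a composition. *)
Lemma transports_ae A B p q T (P : d.-tuple R -> Prop) :
  measurable A -> measurable B -> measurable_fun A p -> measurable_fun B q ->
  (forall x, A x -> (0 < p x)%R) -> (forall y, B y -> (0 <= q y)%R) ->
  transports A B p q T ->
  {ae leb d, forall y, B y -> P y} -> {ae leb d, forall x, A x -> P (T x)}.
Proof.
move=> mA mB mp mq p0 q0 [mT TB E] [N [mN N0 BN]].
have mpE : measurable_fun A (EFin \o p) by exact/measurable_EFinP.
have mqE : measurable_fun B (EFin \o q) by exact/measurable_EFinP.
pose i (y : d.-tuple R) : \bar R := (\1_N y)%:E.
have mi : measurable_fun setT i by apply/measurable_EFinP; exact: measurable_indic.
have i0 y : 0 <= i y by rewrite lee_fin.
have miT : measurable_fun A (i \o T) by exact: measurableT_comp.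
have int0 : \int[leb d]_(x in A) (i (T x) * (p x)%:E) = 0.
  rewrite E//; last exact: measurable_funTS.
  rewrite (_ : 0 = \int[leb d]_(y in B) (cst 0 y))//; last by rewrite integral0.
  apply: ge0_ae_eq_integral => //.
  - by apply: emeasurable_funM => //; exact: measurable_funTS.
  - by move=> y By; rewrite mule_ge0// lee_fin q0.
  exists N; split => // y /not_implyP[By].
  rewrite /i indicE; apply: contra_notP => yN.
  by rewrite memNset// mul0e.
have : ae_eq (leb d) A (fun x => i (T x) * (p x)%:E) (cst 0).
  apply/ae_eq_integral_abs => //; first exact: emeasurable_funM.
  rewrite -[RHS]int0; apply: eq_integral => x /set_mem Ax.
  by rewrite gee0_abs// mule_ge0// lee_fin ltW// p0.
apply: filterS => x + Ax => /(_ Ax) /eqP.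
rewrite mule_eq0 orbC eqe gt_eqF ?p0//= /i indicE eqe pnatr_eq0 eqb0 => /negP NTx.
apply: contrapT => nP; apply: NTx; rewrite inE; apply: BN => /= H.
by apply: nP; exact/H/TB.
Qed.

(** Almost everywhere [r x = r (S (T x))], so the factor [r] is a function of [T x] and can be
    absorbed into the test function. *)
Lemma transports_density A B p q r T S :
  measurable A -> measurable B -> measurable_fun A p -> measurable_fun A r ->
  (forall x, A x -> (0 <= p x)%R) -> (forall x, A x -> (0 <= r x)%R) ->
  measurable_fun B S -> (forall y, B y -> A (S y)) ->
  transports A B p q T -> {ae leb d, forall x, A x -> S (T x) = x} ->
  transports A B (fun x => r x * p x)%R (fun y => r (S y) * q y)%R T.
Proof.
move=> mA mB mp mr p0 r0 mS SA [mT TB E] STK; split => // phi mphi phi0.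
have mpE : measurable_fun A (EFin \o p) by exact/measurable_EFinP.
have mrE : measurable_fun A (EFin \o r) by exact/measurable_EFinP.
have mrS : measurable_fun B (EFin \o r \o S) by exact: (measurable_comp_in mA).
under [RHS]eq_integral do rewrite EFinM muleA.
have r0E x : A x -> 0 <= (EFin \o r) x by move=> Ax; rewrite lee_fin r0.
rewrite -(E (fun y => phi y * (r (S y))%:E)); last 2 first.
- exact: emeasurable_funM.
- by move=> y By; rewrite mule_ge0 ?phi0//; exact/r0E/SA.
have mphiT : measurable_fun A (phi \o T) by exact: (measurable_comp_in mB).
apply: ge0_ae_eq_integral => //.
- apply: emeasurable_funM => //; under eq_fun do rewrite EFinM.
  exact: emeasurable_funM.
- apply: emeasurable_funM => //; apply: emeasurable_funM => //.
  exact: (measurable_comp_in (f := EFin \o r \o S) mB).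
- by move=> x Ax; rewrite mule_ge0 ?lee_fin ?mulr_ge0 ?p0 ?r0//; exact/phi0/TB.
- move=> x Ax; rewrite !mule_ge0 ?lee_fin ?p0 ?r0//; first exact/phi0/TB.
  exact/SA/TB.
- by apply: filterS STK => x + Ax => /(_ Ax) ->; rewrite EFinM muleA.
Qed.

(** Extension by 0 replaces the domain by the whole space, where the induction on the dimension was
    carried out. *)
Lemma cond_cdf_patch A p (i : 'I_d) x :
  cond_cdf A p i x = cond_cdf setT (p \_ A) i x.
Proof.
rewrite /cond_cdf /Rintegral; congr (fine _ / fine _)%R.
- rewrite integral_mkcond [RHS]integral_mkcond; apply: eq_integral => z _.
  have memE B : (z \in [set z : (d - i).-tuple R | B (splice i x z) /\
      (nth 0 z 0%N <= tnth x i)%R]) =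
      (splice i x z \in B) && (nth 0 z 0%N <= tnth x i)%R.
    apply/idP/andP => [/set_mem[/= Bz zi]|[/set_mem Bz zi]]; last by rewrite inE.
    by rewrite inE.
  rewrite !patchE !memE in_setT/=.
  by case: (nth 0 z 0%N <= tnth x i)%R; rewrite ?andbT ?andbF//; case: ifP.
- rewrite integral_mkcond; apply: eq_integral => z _; rewrite !patchE.
  have -> : (z \in [set z : (d - i).-tuple R | A (splice i x z)]) =
      (splice i x z \in A).
    by apply/idP/idP => /set_mem; rewrite inE.
  by case: ifP.
Qed.

Lemma rosenblatt_patch A p : rosenblatt A p = rosenblatt setT (p \_ A).
Proof.
by apply/funext => x; apply: eq_from_tnth => i; rewrite !tnth_mktuple cond_cdf_patch.
Qed.

(* In [cond_cdf], the sets of tuples are elaborated as sets of sequences composed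
   with a coercion, so they are replaced up to conversion and not by rewriting. *)
Lemma rosenblatt_unit_cube p x : measurable_fun setT p ->
  (forall x, (0 <= p x)%R) -> unit_cube (rosenblatt setT p x).
Proof.
move=> mp p0 i; rewrite tnth_mktuple.
pose D1 := [set z : (d - i).-tuple R | [set: d.-tuple R] (splice i x z) /\
  (nth 0%R z 0%N <= tnth x i)%R].
have -> : cond_cdf setT p i x = (\int[leb (d - i)]_(z in D1) p (splice i x z) /
  \int[leb (d - i)]_(z in setT) p (splice i x z))%R by [].
rewrite /= in_itv/=.
have f0 D : 0 <= \int[leb (d - i)]_(z in D) (p (splice i x z))%:E.
  by apply: integral_ge0 => z _; rewrite lee_fin.
have mf : measurable_fun setT (fun z : (d - i).-tuple R => (p (splice i x z))%:E).
  apply/measurable_EFinP.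
  have h := measurableT_comp mp (measurable_splice (ltnW (ltn_ord i))).
  exact: (measurableT_comp h (pair1_measurable x)).
have leD : \int[leb (d - i)]_(z in D1) (p (splice i x z))%:E <=
    \int[leb (d - i)]_(z in setT) (p (splice i x z))%:E.
  have mD1 : measurable D1.
    pose j : 'I_(d - i) := Ordinal (etrans (subn_gt0 i d) (ltn_ord i)).
    rewrite (_ : D1 = (@tnth (d - i) R ^~ j) @^-1` `]-oo, tnth x i]%classic).
      rewrite -[X in measurable X]setTI.
      by apply: measurable_tnth => //; exact: measurable_itv.
    apply/seteqP; split => z; rewrite /D1/= in_itv/= (tnth_nth 0%R z)//=.
    by case.
  apply: ge0_subset_integral => //.
  by move=> z _; rewrite lee_fin.
apply/andP; split; first by apply: divr_ge0; exact: fine_ge0.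
(* An infinite denominator has real value 0, and division by 0 gives 0. The degenerate quotients
   thus stay in the unit interval, and the map sends every point to the cube. *)
have [D2fin|D2inf] := boolP
    (\int[leb (d - i)]_(z in setT) (p (splice i x z))%:E \is a fin_num); last first.
  rewrite [X in (_ / X)%R](_ : _ = 0%R) ?invr0 ?mulr0 ?ler01//.
  by move: D2inf; rewrite /Rintegral fin_numE => /nandP[]/negPn/eqP ->.
have D1fin : \int[leb (d - i)]_(z in D1) (p (splice i x z))%:E \is a fin_num.
  rewrite ge0_fin_numE//; apply: le_lt_trans leD _.
  by rewrite -ge0_fin_numE.
have D12 : (\int[leb (d - i)]_(z in D1) p (splice i x z) <=
    \int[leb (d - i)]_(z in setT) p (splice i x z))%R.
  by rewrite fine_le.
have [D20|D20] := eqVneq (\int[leb (d - i)]_(z in setT) p (splice i x z))%R 0%R.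
  by rewrite D20 invr0 mulr0 ler01.
by rewrite ler_pdivrMr ?mul1r// lt0r D20 fine_ge0.
Qed.

Lemma transports_rosenblatt A p :
  measurable A -> measurable_fun A p -> (forall x, A x -> (0 <= p x)%R) ->
  \int[leb d]_(x in A) (p x)%:E = 1 ->
  transports A unit_cube p (cst 1%R) (rosenblatt A p).
Proof.
move=> mA mp p0 p1; rewrite rosenblatt_patch; set P := p \_ A.
have mP : measurable_fun setT P by exact: (measurable_restrictT p mA).1.
have P0 x : (0 <= P x)%R.
  by rewrite /P patchE; case: ifPn => // /set_mem; exact: p0.
have mR := measurable_rosenblatt mP P0.
have Rc x := rosenblatt_unit_cube x mP P0.
have mc := @measurable_unit_cube R d.
split => //; first exact: measurable_funTS.
move=> phi mphi phi0.
have PE : EFin \o P = (EFin \o p) \_ A.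
  by apply/funext => x; rewrite /= /P !patchE; case: ifP.
have P1 : \int[leb d]_x (P x)%:E = 1.
  by rewrite -p1 [RHS]integral_mkcond -PE.
have mphi' : measurable_fun setT (phi \_ unit_cube).
  exact: (measurable_restrictT phi mc).1.
have phi'0 x : 0 <= (phi \_ unit_cube) x by exact: erestrict_ge0.
have := rosenblatt_pushforward mP P0 P1 mphi' phi'0; rewrite mul1e.
rewrite [X in _ = X -> _](_ : _ = \int[leb d]_(x in unit_cube) (phi x * (cst 1%R x)%:E)).
  move=> <-; rewrite integral_mkcond; apply: eq_integral => x _.
  rewrite patchE [in RHS]patchE (mem_set (Rc x)).
  by rewrite /P patchE; case: ifP => _; rewrite ?mule0.
by apply: eq_integral => x xc; rewrite patchE xc /= mule1.
Qed.

End transports.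

(** * Product domains and maps of marginal cdfs *)

Section boxes.
Context {R : realType} {d : nat}.
Local Open Scope ereal_scope.
Local Notation leb1 := (@lebesgue_measure R).
Implicit Types (D : 'I_d -> set R) (w : 'I_d -> R -> R).

Lemma measurable_box D : (forall i, measurable (D i)) -> measurable (box D).
Proof.
move=> mD.
rewrite (_ : box D = \bigcap_(i in [set: 'I_d]) (@tnth d R ^~ i) @^-1` D i).
  apply: fin_bigcap_measurable => // i _.
  by rewrite -[X in measurable X]setTI; exact: measurable_tnth.
by apply/seteqP; split=> [x Hx i _|x Hx i]; [exact: Hx|exact: (Hx i I)].
Qed.

Lemma measurable_prodfun D w : (forall i, measurable (D i)) ->
  (forall i, measurable_fun (D i) (w i)) -> measurable_fun (box D) (prodfun w).
Proof.
move=> mD mw; apply: measurable_prod => i _.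
apply: (measurable_comp_in (mD i) (mw i)); last by move=> x; exact.
by apply: measurable_funTS; exact: measurable_tnth.
Qed.

Lemma prodfun_patch D w x :
  (prodfun w \_ (box D)) x = (\prod_(i < d) ((w i) \_ (D i)) (tnth x i))%R.
Proof.
rewrite patchE; case: ifPn => [/set_mem Dx|/negP nDx].
  by apply: eq_bigr => i _; rewrite patchE mem_set//; exact: Dx.
have /existsNP[i nDi] : ~ (forall i, D i (tnth x i)).
  by move=> H; apply: nDx; rewrite inE.
by rewrite (bigD1 i)//= patchE memNset// mul0r.
Qed.

Lemma transports_cdf D w :
  (forall i, measurable (D i)) -> (forall i, measurable_fun (D i) (w i)) ->
  (forall i t, D i t -> (0 <= w i t)%R) ->
  (forall i, \int[leb1]_(t in D i) (w i t)%:E = 1) ->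
  transports (box D) unit_cube (prodfun w) (cst 1%R)
    (fun x => [tuple \int[leb1]_(t in D i `&` `]-oo, tnth x i]%classic) w i t | i < d]%R).
Proof.
move=> mD mw w0 w1.
(* Extended by 0, the marginals are densities on the whole line, and the range [D i] intersected
   with a ray becomes the ray itself. *)
pose f i := (w i) \_ (D i).
have fE i : EFin \o f i = (EFin \o w i) \_ (D i).
  by apply/funext => t; rewrite /= /f !patchE; case: ifP.
have mf i : measurable_fun setT (f i) by exact: (measurable_restrictT (w i) (mD i)).1.
have mfE i : measurable_fun setT (EFin \o f i) by exact/measurable_EFinP.
have f0 i t : (0 <= f i t)%R.
  by rewrite /f patchE; case: ifPn => // /set_mem; exact: w0.
have f1 i : \int[leb1]_t (f i t)%:E = 1.
  by rewrite -(w1 i) [RHS]integral_mkcond -fE.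
have FE x : [tuple \int[leb1]_(t in D i `&` `]-oo, tnth x i]%classic) w i t | i < d]%R =
            [tuple \int[leb1]_(t in `]-oo, tnth x i]%classic) f i t | i < d]%R.
  apply: eq_from_tnth => i; rewrite !tnth_mktuple /Rintegral; congr fine.
  by rewrite setIC integral_mkcondr -fE.
set F := (F in transports _ _ _ _ F).
have FE' : F = fun x => [tuple \int[leb1]_(t in `]-oo, tnth x i]%classic) f i t | i < d]%R.
  by apply/funext => x; rewrite /F FE.
have mF : measurable_fun setT F.
  rewrite FE'; apply/measurable_fun_tnthP => i.
  rewrite (_ : _ \o _ = (fun t : R => \int[leb1]_(s in `]-oo, t]%classic) f i s)%R \o
      (@tnth d R ^~ i)).
    by apply: measurableT_comp (measurable_tnth i); exact: measurable_cdf (f1 i).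
  by apply/funext => x /=; rewrite tnth_mktuple.
have Fc x : unit_cube (F x).
  move=> i; rewrite FE' tnth_mktuple /= in_itv/=.
  have h0 B : 0 <= \int[leb1]_(t in B) (f i t)%:E.
    by apply: integral_ge0 => t _; rewrite lee_fin.
  have h1 : \int[leb1]_(t in `]-oo, tnth x i]%classic) (f i t)%:E <= 1.
    rewrite -(f1 i); apply: ge0_subset_integral => //; first exact: mfE.
    by move=> t _; rewrite lee_fin.
  apply/andP; split; first exact: fine_ge0.
  by rewrite -lee_fin fineK// ge0_fin_numE// (le_lt_trans h1)// ltry.
have mc := @measurable_unit_cube R d.
split => //; first exact: measurable_funTS.
move=> phi mphi phi0.
have mphi' : measurable_fun setT (phi \_ unit_cube).
  exact: (measurable_restrictT phi mc).1.
have phi'0 x : 0 <= (phi \_ unit_cube) x by exact: erestrict_ge0.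
have := cdf_product_pushforward mf f0 f1 mphi' phi'0.
rewrite [X in _ = X -> _](_ : _ = \int[leb d]_(x in unit_cube) (phi x * (cst 1%R x)%:E)).
  move=> <-; rewrite integral_mkcond; apply: eq_integral => x _.
  rewrite patchE -prodfun_patch [in RHS]patchE.
  have := Fc x; rewrite {1}FE' => /mem_set ->.
  by rewrite FE' patchE; case: ifP => _; rewrite ?mule0.
by apply: eq_integral => x xc; rewrite patchE xc /= mule1.
Qed.

End boxes.

(** * The layers of a DIRT and their composition *)

Section dirt_layers.
Context {R : realType} {d : nat} (S : dirt R d) (S_ok : dirt_assumptions S).
Local Open Scope ereal_scope.
Implicit Types j k : nat.

Lemma measurable_spaceX : measurable (spaceX S).
Proof. by apply: measurable_box => i; exact: (measurable_domX S_ok). Qed.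

Lemma measurable_spaceU : measurable (spaceU S).
Proof. by apply: measurable_box => i; exact: (measurable_domU S_ok). Qed.

Lemma measurable_layer_dom j : measurable (layer_dom S j).
Proof. by case: j => [|j]; [exact: measurable_spaceX|exact: measurable_spaceU]. Qed.

Lemma measurable_lam : measurable_fun (spaceX S) (lam S).
Proof. exact: (measurable_prodfun (measurable_domX S_ok) (measurable_lambda S_ok)). Qed.

Lemma measurable_omg : measurable_fun (spaceU S) (omg S).
Proof. exact: (measurable_prodfun (measurable_domU S_ok) (measurable_omega S_ok)). Qed.

Lemma measurable_fU_prod : measurable_fun (spaceU S) (fU S).
Proof. exact: (measurable_prodfun (measurable_domU S_ok) (measurable_fU S_ok)). Qed.

Lemma measurable_layer_wgt j : measurable_fun (layer_dom S j) (layer_wgt S j).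
Proof. by case: j => [|j]; [exact: measurable_lam|exact: measurable_omg]. Qed.

Lemma lam_gt0 x : spaceX S x -> (0 < lam S x)%R.
Proof. by move=> Xx; apply: prodr_gt0 => i _; exact: (lambda_gt0 S_ok (Xx i)). Qed.

Lemma omg_gt0 u : spaceU S u -> (0 < omg S u)%R.
Proof. by move=> Uu; apply: prodr_gt0 => i _; exact: (omega_gt0 S_ok (Uu i)). Qed.

Lemma fU_prod_gt0 u : spaceU S u -> (0 < fU S u)%R.
Proof. by move=> Uu; apply: prodr_gt0 => i _; exact: (fU_gt0 S_ok (Uu i)). Qed.

Lemma layer_wgt_gt0 j x : layer_dom S j x -> (0 < layer_wgt S j x)%R.
Proof. by case: j => [|j]; [exact: lam_gt0|exact: omg_gt0]. Qed.

Lemma transports_refmap :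
  transports (spaceU S) unit_cube (fU S) (cst 1%R) (refmap S).
Proof.
apply: (transports_cdf (measurable_domU S_ok) (measurable_fU S_ok) _ (fU_probability S_ok)).
by move=> i t Dt; exact/ltW/(fU_gt0 S_ok).
Qed.

Lemma integral_fU : \int[leb d]_(u in spaceU S) (fU S u)%:E = 1.
Proof.
have [_ _ /(_ (cst 1%:E))] := transports_refmap.
move=> /(_ (@measurable_cst _ _ _ _ _ _) (fun _ _ => lee01)).
under eq_integral do rewrite /= mul1e.
move=> ->; under eq_integral do rewrite /= mul1e.
rewrite integral_cst; last exact: measurable_unit_cube.
by rewrite mul1e; exact: leb_unit_cube.
Qed.

(** The function [g] serves as a witness that [A] is not a null set: a positive [f] with integral 0
    would make [A] null, and the integral of [g] would vanish. *)
Lemma integral_gt0_positive (A : set (d.-tuple R)) (f g : d.-tuple R -> R) :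
  measurable A -> measurable_fun A f -> measurable_fun A g ->
  (forall x, A x -> (0 < f x)%R) -> (forall x, A x -> (0 <= g x)%R) ->
  0 < \int[leb d]_(x in A) (g x)%:E -> 0 < \int[leb d]_(x in A) (f x)%:E.
Proof.
move=> mA mf mg f0 g0 intg.
have mfE : measurable_fun A (EFin \o f) by exact/measurable_EFinP.
have mgE : measurable_fun A (EFin \o g) by exact/measurable_EFinP.
have if0 : 0 <= \int[leb d]_(x in A) (f x)%:E.
  by apply: integral_ge0 => x /f0/ltW; rewrite lee_fin.
rewrite lt0e if0 andbT; apply/negP => /eqP f_eq0; move: intg.
have : ae_eq (leb d) A (EFin \o f) (cst 0).
  apply/ae_eq_integral_abs => //; rewrite -[RHS]f_eq0.
  by apply: eq_integral => x /set_mem /f0 fx; rewrite /= gtr0_norm.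
move=> aef; rewrite (_ : \int[leb d]_(x in A) _ = 0) ?ltxx//.
rewrite (_ : 0 = \int[leb d]_(y in A) (cst 0 y))//; last by rewrite integral0.
apply: ge0_ae_eq_integral => //.
apply: filterS aef => x + Ax => /(_ Ax) /= /eqP.
by rewrite eqe gt_eqF ?f0.
Qed.

(** The domains are shown not to be null by the mass of [pi_0] on X and by the probability density
    [f_U] on U. The positivity of [zhat] rests on this. *)
Lemma integral_layer_wgt_gt0 j :
  0 < \int[leb d]_(x in layer_dom S j) (layer_wgt S j x)%:E.
Proof.
have mD := measurable_layer_dom; have mw := measurable_layer_wgt.
case: j => [|j].
  have /andP[b0 _] := bridge_mass S_ok (leq0n _).
  apply: (integral_gt0_positive (mD 0%N) (mw 0%N) _ lam_gt0 _ b0).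
    by apply: measurable_funM measurable_lam; exact: measurable_bridge.
  by move=> x Xx; rewrite mulr_ge0 ?(ltW (lam_gt0 Xx))//; exact: bridge_ge0.
apply: (integral_gt0_positive (mD j.+1) (mw j.+1) measurable_fU_prod omg_gt0).
  by move=> x /fU_prod_gt0/ltW.
by rewrite integral_fU lte01.
Qed.

Lemma integral_layer_wgt_fin j :
  \int[leb d]_(x in layer_dom S j) (layer_wgt S j x)%:E \is a fin_num.
Proof.
rewrite ge0_fin_numE; last exact/ltW/integral_layer_wgt_gt0.
by case: j => [|j]; [exact: lambda_finite|exact: omega_finite].
Qed.

Lemma integral_approx_fin j : (j <= nlayers S)%N ->
  \int[leb d]_(x in layer_dom S j) (tt_approx S j x ^+ 2 * layer_wgt S j x)%:E
    \is a fin_num.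
Proof.
move=> jn; have := approx_L2 S_ok jn; rewrite /L2norm.
have i0 : 0 <= \int[leb d]_(x in layer_dom S j)
    (tt_approx S j x ^+ 2 * layer_wgt S j x)%:E.
  by apply: integral_ge0 => x /layer_wgt_gt0/ltW w0; rewrite lee_fin mulr_ge0// sqr_ge0.
rewrite ge0_fin_numE// => fin.
rewrite -(poweRe1 i0) -(@mulVf _ (2 : R)) ?pnatr_eq0// poweRrM.
exact: poweR_lty.
Qed.

Lemma zhat_gt0 j : (j <= nlayers S)%N -> (0 < zhat S j)%R.
Proof.
move=> jn; rewrite /zhat ltr_wpDr//.
  apply: fine_ge0; apply: integral_ge0 => x /layer_wgt_gt0/ltW w0.
  by rewrite lee_fin mulr_ge0// sqr_ge0.
rewrite mulr_gt0//; first exact: gam_gt0.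
by rewrite fine_gt0// integral_layer_wgt_gt0 -ge0_fin_numE ?integral_layer_wgt_fin//
  ltW// integral_layer_wgt_gt0.
Qed.

Lemma gamD_gt0 j x : (j <= nlayers S)%N -> (0 < gam S j + tt_approx S j x ^+ 2)%R.
Proof. by move=> jn; rewrite ltr_wpDr ?sqr_ge0//; exact: gam_gt0. Qed.

Lemma layer_density_gt0 j x : (j <= nlayers S)%N -> layer_dom S j x ->
  (0 < layer_density S j x)%R.
Proof.
move=> jn Dx; rewrite /layer_density divr_gt0 ?zhat_gt0// mulr_gt0 ?gamD_gt0//.
exact: layer_wgt_gt0.
Qed.

Lemma measurable_gamD j : (j <= nlayers S)%N ->
  measurable_fun (layer_dom S j) (fun x => gam S j + tt_approx S j x ^+ 2)%R.
Proof.
move=> jn; apply: measurable_funD => //; apply: measurable_funX.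
exact: measurable_approx.
Qed.

Lemma measurable_layer_density j : (j <= nlayers S)%N ->
  measurable_fun (layer_dom S j) (layer_density S j).
Proof.
move=> jn; apply: measurable_funM => //; apply: measurable_funM.
  exact: measurable_gamD.
exact: measurable_layer_wgt.
Qed.

Lemma integral_layer_density j : (j <= nlayers S)%N ->
  \int[leb d]_(x in layer_dom S j) (layer_density S j x)%:E = 1.
Proof.
move=> jn; have mD := measurable_layer_dom j.
have mw : measurable_fun (layer_dom S j) (EFin \o layer_wgt S j).
  by apply/measurable_EFinP; exact: measurable_layer_wgt.
have mgw : measurable_fun (layer_dom S j)
    (fun x => (tt_approx S j x ^+ 2 * layer_wgt S j x)%:E).
  apply/measurable_EFinP; apply: measurable_funM; last exact: measurable_layer_wgt.
  by apply: measurable_funX; exact: measurable_approx.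
have w0 x : layer_dom S j x -> 0 <= (layer_wgt S j x)%:E.
  by move=> /layer_wgt_gt0/ltW; rewrite lee_fin.
have gw0 x : layer_dom S j x -> 0 <= (tt_approx S j x ^+ 2 * layer_wgt S j x)%:E.
  by move=> /w0; rewrite !lee_fin => ?; rewrite mulr_ge0// sqr_ge0.
have g0 : (0 <= gam S j)%R by exact/ltW/(gam_gt0 S_ok jn).
have z0 := zhat_gt0 jn.
transitivity (\int[leb d]_(x in layer_dom S j) ((zhat S j)^-1%:E *
   ((gam S j)%:E * (layer_wgt S j x)%:E +
     (tt_approx S j x ^+ 2 * layer_wgt S j x)%:E))).
  apply: eq_integral => x _; rewrite /layer_density mulrC EFinM; congr (_ * _).
  by rewrite mulrDl EFinD EFinM.
rewrite ge0_integralZl//; last 3 first.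
- by apply: emeasurable_funD => //; exact: measurable_funeM.
- by move=> x Dx; rewrite adde_ge0 ?gw0// mule_ge0 ?w0// lee_fin.
- by rewrite lee_fin invr_ge0 ltW.
rewrite ge0_integralD//; last 2 first.
- by move=> x Dx; rewrite mule_ge0 ?w0// lee_fin.
- exact: measurable_funeM.
rewrite ge0_integralZl// -(fineK (integral_layer_wgt_fin j)).
rewrite -(fineK (integral_approx_fin jn)) -(EFinM (gam S j)) -EFinD -EFinM.
by rewrite mulVf// gt_eqF.
Qed.

End dirt_layers.

Section dirt_composition.
Context {R : realType} {d : nat} (S : dirt R d) (S_ok : dirt_assumptions S).
Local Open Scope ereal_scope.
Implicit Types j k : nat.

Let mU := measurable_spaceU S_ok.
Let mX := measurable_spaceX S_ok.
Let mc := @measurable_unit_cube R d.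

Lemma transports_eq (A B : set (d.-tuple R)) p p' q q' T :
  (forall x, A x -> p x = p' x) -> (forall y, B y -> q y = q' y) ->
  transports A B p q T -> transports A B p' q' T.
Proof.
move=> pp' qq' [mT TB E]; split => // phi mphi phi0.
transitivity (\int[leb d]_(x in A) (phi (T x) * (p x)%:E)).
  by apply: eq_integral => x /set_mem Ax; rewrite pp'.
by rewrite E//; apply: eq_integral => y /set_mem By; rewrite qq'.
Qed.

Lemma transports_layer_rosenblatt j : (j <= nlayers S)%N ->
  transports (layer_dom S j) unit_cube (layer_density S j) (cst 1%R)
    (rosenblatt (layer_dom S j) (layer_density S j)).
Proof.
move=> jn; apply: transports_rosenblatt.
- exact: measurable_layer_dom.
- exact: measurable_layer_density.
- by move=> x Dx; exact/ltW/layer_density_gt0.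
- exact: integral_layer_density.
Qed.

Lemma transports_transport j : (j <= nlayers S)%N ->
  transports unit_cube (layer_dom S j) (cst 1%R) (layer_density S j) (transport S j).
Proof.
move=> jn; apply: (transports_inverse _ mc _ _ (transports_layer_rosenblatt jn)).
- exact: measurable_layer_dom.
- exact: measurable_layer_density.
- by move=> x Dx; exact/ltW/layer_density_gt0.
- exact: (transportP S_ok jn).
Qed.

Lemma transports_layer_map j : (j <= nlayers S)%N ->
  transports (spaceU S) (layer_dom S j) (fU S) (layer_density S j) (layer_map S j).
Proof.
move=> jn; apply: (transports_comp mc _ (transports_refmap S_ok)).
  exact: measurable_layer_dom.
exact: transports_transport.
Qed.

Lemma measurable_layer_map_inv j : (j <= nlayers S)%N ->
  measurable_fun (layer_dom S j) (layer_map_inv S j).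
Proof.
move=> jn; have [mG _ _ _] := refmap_invP S_ok.
have [mF FB _] := transports_layer_rosenblatt jn.
exact: (measurable_comp_in mc mG mF FB).
Qed.

Lemma layer_map_inv_spaceU j x : (j <= nlayers S)%N ->
  layer_dom S j x -> spaceU S (layer_map_inv S j x).
Proof.
move=> jn Dx; have [_ GU _ _] := refmap_invP S_ok.
have [_ FB _] := transports_layer_rosenblatt jn.
exact/GU/FB.
Qed.

(** The Rosenblatt map undoes the transport only almost everywhere on the cube; [transports_ae]
    along [refmap] turns this into a property of almost every [u]. *)
Lemma layer_map_invK j : (j <= nlayers S)%N ->
  {ae leb d, forall u, spaceU S u -> layer_map_inv S j (layer_map S j u) = u}.
Proof.
move=> jn; have [_ _ refK _] := refmap_invP S_ok.
have [_ _ _ rosK] := transportP S_ok jn.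
have := transports_ae mU mc (measurable_fU_prod S_ok) (measurable_cst _) (fU_prod_gt0 S_ok)
  (fun _ _ => ler01) (transports_refmap S_ok) rosK.
apply: filterS2 refK => u refK rosK' Uu.
by rewrite /layer_map_inv /layer_map rosK'// refK.
Qed.

Let ratio j u := ((gam S j + tt_approx S j u ^+ 2) * omg S u / fU S u)%R.

Lemma pihatS k x : pihat S k.+1 x = (pihat S k x * ratio k.+1 (Tbar_inv S k x))%R.
Proof. by rewrite /pihat big_nat_recr//= mulrA. Qed.

Lemma ratio_gt0 j u : (j <= nlayers S)%N -> spaceU S u -> (0 < ratio j u)%R.
Proof.
move=> jn Uu; rewrite /ratio divr_gt0 ?(fU_prod_gt0 S_ok)// mulr_gt0 ?(omg_gt0 S_ok)//.
exact: gamD_gt0.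
Qed.

Lemma measurable_ratio j : (0 < j <= nlayers S)%N -> measurable_fun (spaceU S) (ratio j).
Proof.
case: j => // j jn; apply: measurable_funM.
  apply: measurable_funM; last exact: measurable_omg.
  exact: (measurable_gamD S_ok jn).
by apply: measurable_invr; exact: (measurable_fU_prod S_ok).
Qed.

Lemma zbar_gt0 k : (k <= nlayers S)%N -> (0 < zbar S k)%R.
Proof.
move=> kn; rewrite /zbar big_mkord; apply: prodr_gt0 => -[j jk] _ /=.
by apply: zhat_gt0 => //; rewrite (leq_trans _ kn).
Qed.

Lemma Tbar_inv_spec k : (k <= nlayers S)%N ->
  measurable_fun (spaceX S) (Tbar_inv S k) /\
  (forall x, spaceX S x -> spaceU S (Tbar_inv S k x)).
Proof.
elim: k => [|k IH] kn.
  split; first exact: (measurable_layer_map_inv kn).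
  by move=> x; exact: (layer_map_inv_spaceU kn).
have [mT TU] := IH (ltnW kn); split.
  exact: (measurable_comp_in mU (measurable_layer_map_inv kn) mT TU).
by move=> x /TU; exact: (@layer_map_inv_spaceU k.+1).
Qed.

Lemma measurable_pihat k : (k <= nlayers S)%N ->
  measurable_fun (spaceX S) (pihat S k).
Proof.
elim: k => [|k IH] kn.
  rewrite (_ : pihat S 0 = fun x => gam S 0 + tt_approx S 0 x ^+ 2)%R.
    exact: (measurable_gamD S_ok kn).
  by apply/funext => x; rewrite /pihat big_geq// mulr1.
have [mT TU] := Tbar_inv_spec (ltnW kn).
rewrite (_ : pihat S k.+1 = fun x => pihat S k x * ratio k.+1 (Tbar_inv S k x))%R;
  last by apply/funext => x; exact: pihatS.
apply: measurable_funM; first exact: (IH (ltnW kn)).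
exact: (measurable_comp_in mU (measurable_ratio (j := k.+1) kn) mT TU).
Qed.

Lemma pihat_gt0 k x : (k <= nlayers S)%N -> spaceX S x -> (0 < pihat S k x)%R.
Proof.
move=> + Xx; elim: k => [|k IH] kn.
  by rewrite /pihat big_geq// mulr1 gamD_gt0.
rewrite pihatS mulr_gt0 ?IH ?(ltnW kn)// ratio_gt0//.
by have [_ ] := Tbar_inv_spec (ltnW kn); exact.
Qed.

Definition push_density k x := (pihat S k x * lam S x / zbar S k)%R.

(** The two claims are proved together because the density of the next composition is obtained from
    [transports_density], which needs [Tbar_inv S k] as an almost everywhere left inverse. *)
Lemma Tbar_spec k : (k <= nlayers S)%N ->
  transports (spaceU S) (spaceX S) (fU S) (push_density k) (Tbar S k) /\
  {ae leb d, forall u, spaceU S u -> Tbar_inv S k (Tbar S k u) = u}.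
Proof.
elim: k => [|k IH] kn.
  split; last exact: layer_map_invK.
  apply: transports_eq (transports_layer_map kn) => // x _.
  by rewrite /push_density /layer_density /pihat /zbar big_geq// big_nat1 mulr1.
have [TT TK] := IH (ltnW kn).
have [mT TU] := Tbar_inv_spec (ltnW kn).
have LT := transports_layer_map kn.
have mpk : measurable_fun (spaceU S) (layer_density S k.+1).
  exact: (measurable_layer_density S_ok kn).
have pk0 u : spaceU S u -> (0 < layer_density S k.+1 u)%R.
  by move=> Uu; exact: layer_density_gt0.
pose r u := (layer_density S k.+1 u / fU S u)%R.
have f0 := fU_prod_gt0 S_ok.
have mr : measurable_fun (spaceU S) r.
  apply: measurable_funM => //; apply: measurable_invr.
  exact: (measurable_fU_prod S_ok).
split.
  (* The new layer map acts first and sends [f_U] to its layer density, which is written [r * f_U]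
     so that the transport by [Tbar S k] is available. *)
  apply: (transports_comp mU mX LT).
  apply: (@transports_eq _ _ (fun u => r u * fU S u)%R _
    (fun x => r (Tbar_inv S k x) * push_density k x)%R).
  - by move=> u Uu; rewrite /r mulfVK// gt_eqF// f0.
  - move=> x Xx; rewrite /push_density pihatS /r /layer_density /ratio.
    rewrite [zbar S k.+1]/zbar big_nat_recr//= -/(zbar S k).
    rewrite !invfM; ring.
  apply: transports_density TT TK => //.
  - exact: measurable_fU_prod.
  - by move=> u /f0/ltW.
  - by move=> u Uu; rewrite ltW// divr_gt0 ?pk0 ?f0.
have LK := layer_map_invK kn.
have [mL LU _] := LT.
(* The left inverse at level [k] is known at almost every point of U; it is needed at the image of
   [u] under the new layer map. *)
have : {ae leb d, forall u, spaceU S u ->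
    Tbar_inv S k (Tbar S k (layer_map S k.+1 u)) = layer_map S k.+1 u}.
  apply: (transports_ae mU mU (measurable_fU_prod S_ok) mpk f0 _ LT TK).
  by move=> u /pk0/ltW.
by apply: filterS2 LK => u LK' TK' Uu /=; rewrite TK'// LK'.
Qed.

End dirt_composition.

(** * Divergence bounds *)

Section hellinger_bounds.
Context d (T : measurableType d) (R : realType).
Variable mu : {measure set T -> \bar R}.
Local Open Scope ereal_scope.

Lemma ge0_Cauchy_Schwarz (f g : T -> R) :
  measurable_fun setT f -> measurable_fun setT g ->
  (forall x, (0 <= f x)%R) -> (forall x, (0 <= g x)%R) ->
  \int[mu]_x (f x * g x)%:E <=
  (\int[mu]_x (f x ^+ 2)%:E) `^ 2^-1%R * (\int[mu]_x (g x ^+ 2)%:E) `^ 2^-1%R.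
Proof.
move=> mf mg f0 g0.
have half : (2^-1 + 2^-1 = 1 :> R)%R by rewrite [RHS](splitr 1%R) mul1r.
have N2 (h : T -> R) : (forall x, (0 <= h x)%R) ->
    'N[mu]_2%:E[EFin \o h] = (\int[mu]_x (h x ^+ 2)%:E) `^ 2^-1%R.
  move=> h0; rewrite unlock /=; congr (_ `^ _); apply: eq_integral => x _.
  by rewrite ger0_norm// powR_mulrn.
have := hoelder mu mf mg (ltr0n _ 2) (ltr0n _ 2) half.
rewrite Lnorm1 !N2// => /(le_trans _); apply; rewrite le_eqVlt; apply/orP; left.
by apply/eqP/eq_integral => x _; rewrite /= ger0_norm// mulr_ge0.
Qed.

Variables (p q : T -> R).
Hypotheses (mp : measurable_fun setT p) (mq : measurable_fun setT q).
Hypotheses (p0 : forall x, (0 <= p x)%R) (q0 : forall x, (0 <= q x)%R).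
Hypotheses (p1 : \int[mu]_x (p x)%:E = 1) (q1 : \int[mu]_x (q x)%:E = 1).

Let sp x := Num.sqrt (p x).
Let sq x := Num.sqrt (q x).

Lemma measurable_sqrtr (f : T -> R) : measurable_fun setT f ->
  measurable_fun setT (fun x => Num.sqrt (f x)).
Proof.
move=> mf; apply: measurableT_comp mf.
exact: (continuous_measurable_fun (@sqrt_continuous R)).
Qed.

Let msp : measurable_fun setT sp. Proof. exact: measurable_sqrtr. Qed.
Let msq : measurable_fun setT sq. Proof. exact: measurable_sqrtr. Qed.

Let C := \int[mu]_x (sp x * sq x)%:E.

Let C0 : 0 <= C.
Proof. by apply: integral_ge0 => x _; rewrite lee_fin mulr_ge0// sqrtr_ge0. Qed.

Let msqr a b : measurable_fun setT (fun x => ((a * sp x - b * sq x) ^+ 2)%:E).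
Proof.
apply/measurable_EFinP; apply: measurable_funX.
by apply: measurable_funB; exact: measurable_funM.
Qed.

(** The square is expanded with [p] and [q] of mass 1. The cross term stays on the left, so that no
    subtraction in the extended reals occurs while [C] is not yet known to be finite. *)
Let expand a b : (0 <= a)%R -> (0 <= b)%R ->
  \int[mu]_x ((a * sp x - b * sq x) ^+ 2)%:E + (2 * a * b)%:E * C =
  (a ^+ 2 + b ^+ 2)%:E.
Proof.
move=> a0 b0.
have ab0 : 0 <= (2 * a * b)%:E by rewrite lee_fin !mulr_ge0.
have mC : measurable_fun setT (fun x => (sp x * sq x)%:E).
  by apply/measurable_EFinP; exact: measurable_funM.
have C0' x : 0 <= (sp x * sq x)%:E by rewrite lee_fin mulr_ge0// sqrtr_ge0.
rewrite -ge0_integralZl// -ge0_integralD//; last 3 first.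
- by move=> x _; rewrite lee_fin sqr_ge0.
- by move=> x _; rewrite mule_ge0.
- exact: measurable_funeM.
transitivity (\int[mu]_x ((a ^+ 2)%:E * (p x)%:E + (b ^+ 2)%:E * (q x)%:E)).
  apply: eq_integral => x _; rewrite -!EFinM -!EFinD; congr EFin.
  rewrite -[in RHS](sqr_sqrtr (p0 x)) -[in RHS](sqr_sqrtr (q0 x)) -/(sp x) -/(sq x).
  ring.
have mpE : measurable_fun setT (EFin \o p) by exact/measurable_EFinP.
have mqE : measurable_fun setT (EFin \o q) by exact/measurable_EFinP.
have sa x : 0 <= (x ^+ 2)%:E :> \bar R by rewrite lee_fin sqr_ge0.
rewrite ge0_integralD//; last 4 first.
- by move=> x _; rewrite mule_ge0// lee_fin.
- exact: measurable_funeM.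
- by move=> x _; rewrite mule_ge0// lee_fin.
- exact: measurable_funeM.
rewrite !ge0_integralZl ?p1 ?q1 ?mule1//.
- by move=> x _; rewrite lee_fin.
- by move=> x _; rewrite lee_fin.
Qed.

(* No triangle inequality in L2 is needed.  With c the affinity \int sqrt (p q),
   which lies in [0, 1], both integrals are affine in c, and 4 times the first one
   minus s^2 times the second one is
   (1 - c) (2 s^2 + 4 t^2) + c (4 (s - t)^2). *)
Lemma hellinger_sq_le (s t e : R) : (0 < s)%R -> (0 < t)%R ->
  \int[mu]_x ((s * sp x - t * sq x) ^+ 2)%:E <= (e ^+ 2)%:E ->
  \int[mu]_x ((sp x - sq x) ^+ 2)%:E <= (4 * e ^+ 2 / s ^+ 2)%:E.
Proof.
move=> s0 t0 le_e.
have A0 a b : 0 <= \int[mu]_x ((a * sp x - b * sq x) ^+ 2)%:E.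
  by apply: integral_ge0 => x _; rewrite lee_fin sqr_ge0.
have := expand ler01 ler01; have := expand (ltW s0) (ltW t0); have := A0 1%R 1%R.
have -> : \int[mu]_x ((1 * sp x - 1 * sq x) ^+ 2)%:E =
    \int[mu]_x ((sp x - sq x) ^+ 2)%:E.
  by apply: eq_integral => x _; rewrite !mul1r.
move: le_e (A0 s t) C0.
set A := \int[mu]_x ((sp x - sq x) ^+ 2)%:E; set B := \int[mu]_x _.
move=> le_e B0 C0' A0' EB EA.
(* For [a = b = 1] the expansion has the finite value 2, so both summands are finite and the rest is
   real arithmetic. *)
have /andP[Afin CCfin] : (A \is a fin_num) && ((2 * 1 * 1)%:E * C \is a fin_num).
  by rewrite -fin_numD EA.
have Cfin : C \is a fin_num.
  have -> : C = (2^-1)%:E * ((2 * 1 * 1)%:E * C).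
    by rewrite muleA -EFinM !mulr1 mulVf ?mul1e// pnatr_eq0.
  by rewrite fin_numM.
have Bfin : B \is a fin_num.
  by rewrite ge0_fin_numE//; apply: le_lt_trans le_e _; exact: ltry.
move: le_e B0 C0' A0' EB EA.
rewrite -(fineK Afin) -(fineK Bfin) -(fineK Cfin) -!EFinM -!EFinD !lee_fin.
set a := fine A; set b := fine B; set c := fine C => le_e b0 c0 a0 [EB] [EA].
rewrite ler_pdivlMr ?exprn_gt0//.
have cle1 : (c <= 1)%R by lra.
have aE : a = (2 - 2 * c)%R by lra.
have bE : b = (s ^+ 2 + t ^+ 2 - 2 * s * t * c)%R by rewrite -EB; ring.
apply: (@le_trans _ _ (4 * b)%R); last by rewrite ler_pM2l.
rewrite -subr_ge0 (_ : (_ - _)%R =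
  ((1 - c) * (2 * s ^+ 2 + 4 * t ^+ 2) + c * (4 * (s - t) ^+ 2))%R); last first.
  by rewrite aE bE; ring.
rewrite addr_ge0// mulr_ge0 ?subr_ge0//.
  by rewrite addr_ge0// mulr_ge0// sqr_ge0.
by rewrite mulr_ge0// sqr_ge0.
Qed.

Section hellinger_distance_bound.
Variable delta : R.
Hypothesis hellinger_le :
  (\int[mu]_x ((sp x - sq x) ^+ 2)%:E) `^ 2^-1%R <= delta%:E.

Let mabs : measurable_fun setT (fun x => `|sp x - sq x|%R).
Proof. by apply: measurableT_comp => //; exact: measurable_funB. Qed.

Let delta0 : (0 <= delta)%R.
Proof. by rewrite -lee_fin (le_trans _ hellinger_le)// poweR_ge0. Qed.

Let sqrt_abs : \int[mu]_x (`|sp x - sq x| ^+ 2)%:E = \int[mu]_x ((sp x - sq x) ^+ 2)%:E.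
Proof. by apply: eq_integral => x _; rewrite real_normK// num_real. Qed.

Let abs_subE x : `|p x - q x|%R = (`|sp x - sq x| * (sp x + sq x))%R.
Proof.
rewrite -[X in _ = (_ * X)%R]ger0_norm ?addr_ge0 ?sqrtr_ge0// -normrM.
by rewrite -subr_sqr !sqr_sqrtr.
Qed.

Lemma tv_le_hellinger : \int[mu]_x `|p x - q x|%:E <= (2 * delta)%:E.
Proof.
have mD : measurable_fun setT (fun x => sp x + sq x)%R by exact: measurable_funD.
under eq_integral do rewrite abs_subE.
apply: le_trans (ge0_Cauchy_Schwarz mabs mD _ _) _ => // [x|].
  by rewrite addr_ge0 ?sqrtr_ge0.
rewrite sqrt_abs mulrC EFinM; apply: lee_pmul => //; try exact: poweR_ge0.
(* From [(a + b)^2 <= 2 (a^2 + b^2)] and the two unit masses: the second Cauchy-Schwarz factor is at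
   most [sqrt 4], the 2 of the statement. *)
have le4 : \int[mu]_x ((sp x + sq x) ^+ 2)%:E <= 4%:E.
  have mpE : measurable_fun setT (EFin \o p) by exact/measurable_EFinP.
  have mqE : measurable_fun setT (EFin \o q) by exact/measurable_EFinP.
  have -> : 4%:E = \int[mu]_x (2%:E * ((p x)%:E + (q x)%:E)).
    rewrite ge0_integralZl//; last 2 first.
    - exact: emeasurable_funD.
    - by move=> x _; rewrite adde_ge0// lee_fin.
    rewrite ge0_integralD ?p1 ?q1//; try by move=> x _; rewrite lee_fin.
    by rewrite -EFinD -EFinM; congr EFin; ring.
  apply: ge0_le_integral => //.
  - by move=> x _; rewrite lee_fin sqr_ge0.
  - by apply/measurable_EFinP; apply: measurable_funX.
  - by apply: measurable_funeM; exact: emeasurable_funD.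
  move=> x _; rewrite -EFinD -EFinM lee_fin.
  rewrite -[in leRHS](sqr_sqrtr (p0 x)) -[in leRHS](sqr_sqrtr (q0 x)) -/(sp x) -/(sq x).
  by have := sqr_ge0 (sp x - sq x)%R; rewrite -subr_ge0 sqrrB sqrrD; lra.
apply: le_trans (_ : 4%:E `^ 2^-1%R <= _).
  apply: gt0_ler_poweR => //; rewrite in_itv/= leey andbT ?lee_fin//.
  by apply: integral_ge0 => x _; rewrite lee_fin sqr_ge0.
rewrite poweR_EFin lee_fin powR12_sqrt// (_ : 4 = 2 ^+ 2 :> R)%R ?sqrtr_sqr ?ger0_norm//.
by ring.
Qed.

(* h = p / q gives h^2 q - p = h (p - q)
   <= |sqrt p - sqrt q| (h sqrt p + h sqrt q), to which Cauchy-Schwarz applies. *)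
Lemma chi2_le_hellinger (h : T -> R) : measurable_fun setT h ->
  (forall x, (0 <= h x)%R) -> (forall x, h x * q x = p x)%R ->
  \int[mu]_x (h x ^+ 2 * q x)%:E - 1 <=
  ((\int[mu]_x (h x ^+ 2 * p x)%:E) `^ 2^-1%R +
   (\int[mu]_x (h x ^+ 2 * q x)%:E) `^ 2^-1%R) * delta%:E.
Proof.
move=> mh h0 hq.
have CS (r : T -> R) : measurable_fun setT r -> (forall x, 0 <= r x)%R ->
    \int[mu]_x (`|sp x - sq x| * (h x * Num.sqrt (r x)))%:E <=
    (\int[mu]_x (h x ^+ 2 * r x)%:E) `^ 2^-1%R * delta%:E.
  move=> mr r0; rewrite muleC.
  have mhr : measurable_fun setT (fun x => h x * Num.sqrt (r x))%R.
    by apply: measurable_funM => //; exact: measurable_sqrtr.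
  apply: le_trans (ge0_Cauchy_Schwarz mabs mhr _ _) _ => // [x|].
    by rewrite mulr_ge0 ?sqrtr_ge0.
  rewrite sqrt_abs (_ : \int[mu]_x ((h x * Num.sqrt (r x)) ^+ 2)%:E =
    \int[mu]_x (h x ^+ 2 * r x)%:E).
    by apply: lee_wpmul2r => //; exact: poweR_ge0.
  by apply: eq_integral => x _; rewrite exprMn sqr_sqrtr.
rewrite leeBlDr// muleDl//; last by rewrite ge0_adde_def ?inE ?poweR_ge0.
apply: le_trans (leeD2r _ (leeD (CS p mp p0) (CS q mq q0))).
have int1 (r : T -> R) : measurable_fun setT r ->
    measurable_fun setT (fun x => (`|sp x - sq x| * (h x * Num.sqrt (r x)))%:E).
  move=> mr; apply/measurable_EFinP; apply: measurable_funM => //.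
  by apply: measurable_funM => //; exact: measurable_sqrtr.
have int0 (r : T -> R) x : 0 <= (`|sp x - sq x| * (h x * Num.sqrt (r x)))%:E.
  by rewrite lee_fin !mulr_ge0// sqrtr_ge0.
have mpE : measurable_fun setT (EFin \o p) by exact/measurable_EFinP.
(* The 1 is written as the integral of [p], so that a pointwise comparison of the integrands
   suffices. *)
rewrite -[X in _ <= _ + X]p1 -ge0_integralD// -?ge0_integralD//; last 5 first.
- by move=> x _; rewrite adde_ge0.
- by apply: emeasurable_funD; exact: int1.
- by move=> x _; rewrite lee_fin.
- exact: int1.
- exact: int1.
apply: ge0_le_integral => //.
- by move=> x _; rewrite lee_fin mulr_ge0// sqr_ge0.
- apply/measurable_EFinP; apply: measurable_funM => //.
  exact: measurable_funX.
- by apply: emeasurable_funD => //; apply: emeasurable_funD; exact: int1.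
move=> x _; rewrite -!EFinD lee_fin -/(sp x) -/(sq x).
rewrite -mulrDr -mulrDr mulrCA -abs_subE expr2 -mulrA hq -lerBlDr.
rewrite -{2}(hq x) -mulrBr; apply: ler_wpM2l => //; exact: ler_norm.
Qed.

End hellinger_distance_bound.

End hellinger_bounds.

(** * Chosen densities, set functions with a density and absolute continuity *)

Section densities.
Context {R : realType} {d : nat}.
Local Open Scope ereal_scope.
Implicit Types (m : set (d.-tuple R) -> \bar R) (p q : d.-tuple R -> R).

(** Integrable functions with equal integrals over all measurable sets agree almost everywhere, so
    the choice made by [density_of] can be compared with an explicit density. *)
Lemma density_of_ae m p : is_density m p -> \int[leb d]_x (p x)%:E < +oo ->
  is_density m (density_of m) /\ {ae leb d, forall x, density_of m x = p x}.
Proof.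
move=> mp pfin.
have md : is_density m (density_of m).
  by apply: (@xgetPex _ (cst 0%R) [set p | is_density m p]); exists p.
split=> //; have [[mpm p0 pE] [mdm d0 dE]] := (mp, md).
have mpE : measurable_fun setT (EFin \o p) by exact/measurable_EFinP.
have : ae_eq (leb d) setT (EFin \o p) (EFin \o density_of m).
  apply: integral_ae_eq => //.
  - apply/integrableP; split => //.
    by under eq_integral do rewrite gee0_abs ?lee_fin//.
  - exact/measurable_EFinP.
  - by move=> E _ mE; rewrite -pE// dE.
by apply: filterS => x /(_ I) /= [->].
Qed.

(** All three divergences are integrals of this form, for three different [f]; this replaces the
    chosen densities in them by explicit ones. *)
Lemma integral_density_of m1 m2 p q (f : R -> R -> R) :
  is_density m1 p -> is_density m2 q ->
  \int[leb d]_x (p x)%:E < +oo -> \int[leb d]_x (q x)%:E < +oo ->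
  (forall (g h : d.-tuple R -> R), measurable_fun setT g -> measurable_fun setT h ->
    measurable_fun setT (fun x => f (g x) (h x))) ->
  \int[leb d]_x (f (density_of m1 x) (density_of m2 x))%:E =
  \int[leb d]_x (f (p x) (q x))%:E.
Proof.
move=> mp mq pfin qfin mf.
have [[md1 _ _] ae1] := density_of_ae mp pfin.
have [[md2 _ _] ae2] := density_of_ae mq qfin.
case: mp mq => [mpm _ _] [mqm _ _].
apply: ae_eq_integral => //.
- by apply/measurable_EFinP; exact: mf.
- by apply/measurable_EFinP; exact: mf.
by apply: filterS2 ae1 ae2 => x -> ->.
Qed.

Import HBNNSimple.

(* [eq_measure_integral] does not apply: a set function such as
   [pushforward m f] with [f] not measurable is no measure, and only its values
   on measurable sets enter the integral. *)
Lemma eq_set_function_integral d' (T : measurableType d') (m1 m2 : set T -> \bar R)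
    (D : set T) (f : T -> \bar R) :
  (forall A, measurable A -> m1 A = m2 A) ->
  \int[m1]_(x in D) f x = \int[m2]_(x in D) f x.
Proof.
move=> m12.
have sE (h : {nnsfun T >-> R}) : sintegral m1 h = sintegral m2 h.
  by apply: eq_fsbigr => x _; congr (_ * _); apply: m12; exact: measurable_funPTI.
rewrite /integral; congr (ereal_sup _ - ereal_sup _);
  by apply/seteqP; split => y [h hg <-]; exists h.
Qed.

(** Gives the push-forward, which is only known on measurable sets, a genuine measure with the same
    integrals, so that the library of measures applies. *)
Lemma eq_density_measure m (p : d.-tuple R -> R) : is_density m p ->
  exists m' : {measure set (d.-tuple R) -> \bar R},
    [/\ (forall A, measurable A -> m A = m' A),
        (forall A, measurable A -> m' A = \int[leb d]_(x in A) (p x)%:E) &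
        forall D f, \int[m]_(x in D) f x = \int[m']_(x in D) f x].
Proof.
move=> [mp p0 mE].
have mpE : measurable_fun setT (EFin \o p) by exact/measurable_EFinP.
have [m' m'E] := density_is_measure (leb d) mpE (fun x => p0 x).
exists m'; split => [A mA|//|D f]; first by rewrite mE// m'E.
by apply: eq_set_function_integral => A mA; rewrite mE// m'E.
Qed.

Lemma integral_is_density m p D (f : d.-tuple R -> R) : is_density m p ->
  measurable D -> measurable_fun D f -> (forall x, D x -> (0 <= f x)%R) ->
  \int[m]_(x in D) (f x)%:E = \int[leb d]_x ((f \_ D) x * p x)%:E.
Proof.
move=> dp mD mf f0; have [mp p0 _] := dp.
have [m' [_ m'E ->]] := eq_density_measure dp.
have mpE : measurable_fun setT (EFin \o p) by exact/measurable_EFinP.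
have mfD : measurable_fun setT (f \_ D) by exact: (measurable_restrictT f mD).1.
have fD0 x : (0 <= (f \_ D) x)%R by rewrite patchE; case: ifPn => // /set_mem /f0.
rewrite integral_mkcond (_ : _ \_ D = EFin \o (f \_ D)); last first.
  by apply/funext => x; rewrite /= !patchE; case: ifP.
rewrite (ge0_integral_density mpE _ m'E)//.
exact/measurable_EFinP.
Qed.

Lemma density_null_dominates m1 m2 p q : is_density m1 p -> is_density m2 q ->
  (forall x, q x = 0%R -> p x = 0%R) -> m1 `<< m2.
Proof.
move=> [mp p0 m1E] [mq q0 m2E] qp N N0 A mA AN.
rewrite m1E//.
have mpE : measurable_fun A (EFin \o p) by apply/measurable_EFinP/measurable_funTS.
have mqE : measurable_fun A (EFin \o q) by apply/measurable_EFinP/measurable_funTS.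
have : ae_eq (leb d) A (EFin \o q) (cst 0).
  apply/ae_eq_integral_abs => //; rewrite -[RHS](N0 A mA AN) m2E//.
  by apply: eq_integral => x _; rewrite /= ger0_norm.
move=> aeq; rewrite (_ : 0 = \int[leb d]_(y in A) (cst 0 y))//; last by rewrite integral0.
apply: ge0_ae_eq_integral => //.
- by move=> x _; rewrite lee_fin.
- by apply: filterS aeq => x + Ax => /(_ Ax) /= [/qp ->].
Qed.

End densities.

(** * Densities of the target and of the push-forward *)

Section dirt_densities.
Context {R : realType} {d : nat} (S : dirt R d) (S_ok : dirt_assumptions S).
Context (k : nat) (k_le : (k <= nlayers S)%N).
Local Open Scope ereal_scope.

Let mX := measurable_spaceX S_ok.
Let mU := measurable_spaceU S_ok.

Lemma is_density_patch (f : d.-tuple R -> R) m :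
  measurable_fun (spaceX S) f -> (forall x, spaceX S x -> (0 <= f x)%R) ->
  (forall A, measurable A -> m A = \int[leb d]_(x in A `&` spaceX S) (f x)%:E) ->
  is_density m (f \_ (spaceX S)).
Proof.
move=> mf f0 mE; split.
- exact: (measurable_restrictT f mX).1.
- by move=> x; rewrite patchE; case: ifPn => // /set_mem /f0.
- move=> A mA; rewrite mE// integral_mkcondr; apply: eq_integral => x _.
  by rewrite /= !patchE; case: ifP.
Qed.

Lemma znorm_gt0 : (0 < znorm S k)%R.
Proof.
have /andP[z0 zoo] := bridge_mass S_ok k_le.
by rewrite /znorm fine_gt0// z0.
Qed.

Lemma EFin_znorm :
  (znorm S k)%:E = \int[leb d]_(x in spaceX S) (bridge S k x * lam S x)%:E.
Proof.
have /andP[z0 zoo] := bridge_mass S_ok k_le.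
by rewrite /znorm fineK// ge0_fin_numE// ltW.
Qed.

Definition target_density x := (bridge S k x * lam S x / znorm S k)%R.

Let mtarget : measurable_fun (spaceX S) target_density.
Proof.
apply: measurable_funM => //; apply: measurable_funM (measurable_lam S_ok).
exact: (measurable_bridge S_ok k_le).
Qed.

Let target0 x : spaceX S x -> (0 <= target_density x)%R.
Proof.
move=> Xx; rewrite divr_ge0 ?(ltW znorm_gt0)// mulr_ge0 ?(ltW (lam_gt0 S_ok Xx))//.
exact: (bridge_ge0 S_ok).
Qed.

Let mpush : measurable_fun (spaceX S) (push_density S k).
Proof.
apply: measurable_funM => //; apply: measurable_funM (measurable_lam S_ok).
exact: measurable_pihat.
Qed.

Let push0 x : spaceX S x -> (0 < push_density S k x)%R.
Proof.
move=> Xx; rewrite divr_gt0 ?zbar_gt0// mulr_gt0 ?pihat_gt0//.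
exact: lam_gt0.
Qed.

Lemma nu_target_density :
  is_density (nu_target S k) (target_density \_ (spaceX S)).
Proof. exact: is_density_patch. Qed.

(** This is the transport property of [Tbar S k] tested on an indicator. The reference measure
    intersects every set with U, so only the values of the map on U matter. *)
Lemma push_ref_measure_density :
  is_density (pushforward (ref_measure S) (Tbar S k)) (push_density S k \_ (spaceX S)).
Proof.
apply: is_density_patch => // [x /push0/ltW//|A mA].
have [[mT TX E] _] := Tbar_spec S_ok k_le.
have mi : measurable_fun setT (fun x : d.-tuple R => (\1_A x)%:E : \bar R).
  by apply/measurable_EFinP; exact: measurable_indic.
have := E (fun x => (\1_A x)%:E) (measurable_funTS mi).
move=> /(_ (fun _ _ => ltac:(by rewrite lee_fin))) EA.
rewrite /pushforward /ref_measure /density_measure setIC integral_mkcondr.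
transitivity (\int[leb d]_(u in spaceU S) ((\1_A (Tbar S k u))%:E * (fU S u)%:E)).
  apply: eq_integral => u _; rewrite patchE indicE.
  have -> : (u \in Tbar S k @^-1` A) = (Tbar S k u \in A).
    by apply/idP/idP => /set_mem; rewrite inE.
  by case: ifP => _; rewrite ?mul1e ?mul0e.
rewrite EA setIC integral_mkcondr; apply: eq_integral => x _.
by rewrite patchE indicE; case: ifP => _; rewrite ?mul1e ?mul0e.
Qed.

Lemma integral_target_density :
  \int[leb d]_x ((target_density \_ (spaceX S)) x)%:E = 1.
Proof.
transitivity (\int[leb d]_(x in spaceX S) ((znorm S k)^-1%:E * (bridge S k x * lam S x)%:E)).
  rewrite [RHS]integral_mkcond; apply: eq_integral => x _; rewrite !patchE.
  by case: ifP => // _; rewrite /target_density mulrC EFinM.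
rewrite ge0_integralZl//; last 3 first.
- apply/measurable_EFinP; apply: measurable_funM (measurable_lam S_ok).
  exact: (measurable_bridge S_ok k_le).
- move=> x Xx; rewrite lee_fin mulr_ge0 ?(ltW (lam_gt0 S_ok Xx))//.
  exact: (bridge_ge0 S_ok).
- by rewrite lee_fin invr_ge0 ltW// znorm_gt0.
by rewrite -EFin_znorm -EFinM mulVf// gt_eqF// znorm_gt0.
Qed.

(** The integral of [pihat * lam] is not computed: the push-forward has the total mass of the
    reference measure, which is 1. *)
Lemma integral_push_density :
  \int[leb d]_x ((push_density S k \_ (spaceX S)) x)%:E = 1.
Proof.
have [_ _ /(_ setT measurableT) <-] := push_ref_measure_density.
rewrite /pushforward preimage_setT /ref_measure /density_measure setTI.
exact: integral_fU.
Qed.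

End dirt_densities.

(** * The three bounds for a DIRT *)

Section main_bounds.
Context {R : realType} {d : nat} (S : dirt R d) (S_ok : dirt_assumptions S).
Context (k : nat) (k_le : (k <= nlayers S)%N) (e : R).
Local Open Scope ereal_scope.
Hypothesis err : L2norm (spaceX S) (lam S)
  (fun x => Num.sqrt (bridge S k x) - Num.sqrt (pihat S k x))%R <= e%:E.

Let mX := measurable_spaceX S_ok.
Let p := target_density S k \_ (spaceX S).
Let q := push_density S k \_ (spaceX S).
Let z := znorm S k.
Let zb := zbar S k.
Let z0 : (0 < z)%R. Proof. exact: znorm_gt0. Qed.
Let zb0 : (0 < zb)%R. Proof. exact: zbar_gt0. Qed.
Let dp : is_density (nu_target S k) p. Proof. exact: nu_target_density. Qed.
Let dq : is_density (pushforward (ref_measure S) (Tbar S k)) q.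
Proof. exact: push_ref_measure_density. Qed.
Let p1 : \int[leb d]_x (p x)%:E = 1. Proof. exact: integral_target_density. Qed.
Let q1 : \int[leb d]_x (q x)%:E = 1. Proof. exact: integral_push_density. Qed.
Let mp : measurable_fun setT p. Proof. by case: dp. Qed.
Let mq : measurable_fun setT q. Proof. by case: dq. Qed.
Let p0 x : (0 <= p x)%R. Proof. by case: dp. Qed.
Let q0 x : (0 <= q x)%R. Proof. by case: dq. Qed.

Let e0 : (0 <= e)%R.
Proof. by rewrite -lee_fin (le_trans _ err)// poweR_ge0. Qed.

Let unnormalised_le :
  \int[leb d]_x ((Num.sqrt z * Num.sqrt (p x) - Num.sqrt zb * Num.sqrt (q x)) ^+ 2)%:E
    <= (e ^+ 2)%:E.
Proof.
set I := \int[leb d]_(x in spaceX S) (((Num.sqrt (bridge S k x)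
   - Num.sqrt (pihat S k x)) ^+ 2 * lam S x)%:E).
have I0 : 0 <= I.
  apply: integral_ge0 => x Xx; rewrite lee_fin mulr_ge0 ?sqr_ge0//.
  exact/ltW/(lam_gt0 S_ok).
have Ie : I <= (e ^+ 2)%:E.
  rewrite -(poweRe1 I0) -(@mulVf _ (2 : R)) ?pnatr_eq0// poweRrM.
  rewrite -powR_mulrn// -poweR_EFin.
  apply: gt0_ler_poweR => //; rewrite in_itv/= leey andbT ?lee_fin//.
  exact: poweR_ge0.
apply: le_trans Ie; rewrite le_eqVlt; apply/orP; left; apply/eqP.
rewrite /I [RHS]integral_mkcond; apply: eq_integral => x _.
rewrite /p /q !patchE; case: ifPn => [/set_mem Xx|_]; last first.
  by rewrite sqrtr0 !mulr0 subr0 expr0n.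
have l0 := lam_gt0 S_ok Xx.
have b0 : (0 <= bridge S k x)%R by exact: (bridge_ge0 S_ok).
have h0 : (0 <= pihat S k x)%R by exact/ltW/(pihat_gt0 S_ok).
have sqrtE (b c : R) : (0 <= b)%R -> (0 < c)%R ->
    (Num.sqrt c * Num.sqrt (b * lam S x / c) = Num.sqrt b * Num.sqrt (lam S x))%R.
  move=> b_ge0 c0; rewrite -sqrtrM; last exact: ltW.
  by rewrite mulrC divfK ?gt_eqF// sqrtrM.
rewrite /target_density /push_density !sqrtE// -mulrBl exprMn sqr_sqrtr//.
exact: ltW.
Qed.

Let sqz0 : (0 < Num.sqrt z)%R. Proof. by rewrite sqrtr_gt0. Qed.
Let sqzb0 : (0 < Num.sqrt zb)%R. Proof. by rewrite sqrtr_gt0. Qed.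

Let hell_sq := hellinger_sq_le mp mq p0 q0 p1 q1 sqz0 sqzb0 unnormalised_le.

Let delta := (2 * e / Num.sqrt z)%R.

Let delta0 : (0 <= delta)%R.
Proof. by rewrite /delta divr_ge0// ?mulr_ge0// ltW. Qed.

Let hell_ge0 : 0 <= \int[leb d]_x ((Num.sqrt (p x) - Num.sqrt (q x)) ^+ 2)%:E.
Proof. by apply: integral_ge0 => x _; rewrite lee_fin sqr_ge0. Qed.

Let hell : (\int[leb d]_x ((Num.sqrt (p x) - Num.sqrt (q x)) ^+ 2)%:E) `^ 2^-1%R
  <= delta%:E.
Proof.
have -> : delta%:E = ((4 * e ^+ 2 / Num.sqrt z ^+ 2)%:E) `^ 2^-1%R.
  rewrite poweR_EFin powR12_sqrt; last by rewrite divr_ge0 ?mulr_ge0 ?sqr_ge0.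
  rewrite (_ : (4 * e ^+ 2 / Num.sqrt z ^+ 2) = delta ^+ 2)%R.
    by rewrite sqrtr_sqr ger0_norm.
  by rewrite /delta !exprMn exprVn; congr (_ * _ / _)%R; ring.
apply: gt0_ler_poweR => //; rewrite in_itv/= leey andbT// lee_fin.
by rewrite divr_ge0 ?mulr_ge0 ?sqr_ge0.
Qed.

Let pfin : \int[leb d]_x (p x)%:E < +oo. Proof. by rewrite p1 ltry. Qed.
Let qfin : \int[leb d]_x (q x)%:E < +oo. Proof. by rewrite q1 ltry. Qed.

Lemma D_H_bound : D_H (nu_target S k) (pushforward (ref_measure S) (Tbar S k))
  <= (Num.sqrt 2 * e / Num.sqrt z)%:E.
Proof.
rewrite /D_H /=.
rewrite (integral_density_of (f := fun a b => ((Num.sqrt a - Num.sqrt b) ^+ 2)%R) dp dq pfin qfin);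
  last first.
  move=> g h mg mh; apply: measurable_funX.
  by apply: measurable_funB; exact: measurable_sqrtr.
(* The squared bound [hell_sq] is used directly: half of [4 e^2 / z] is [2 e^2 / z], whence the
   constant [sqrt 2]. *)
apply: (@le_trans _ _ ((2^-1%:E * (4 * e ^+ 2 / Num.sqrt z ^+ 2)%:E) `^ 2^-1%R)).
  apply: gt0_ler_poweR => //.
  - by rewrite in_itv/= leey andbT mule_ge0// lee_fin.
  - by rewrite in_itv/= leey andbT -EFinM lee_fin mulr_ge0// divr_ge0 ?mulr_ge0 ?sqr_ge0.
  - by apply: lee_wpmul2l => //; rewrite lee_fin.
rewrite -EFinM poweR_EFin lee_fin powR12_sqrt; last first.
  by rewrite mulr_ge0// divr_ge0 ?mulr_ge0 ?sqr_ge0.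
rewrite (_ : (_ * (_ / _))%R = ((Num.sqrt 2 * e / Num.sqrt z) ^+ 2)%R).
  by rewrite sqrtr_sqr ger0_norm// divr_ge0 ?mulr_ge0 ?sqrtr_ge0.
rewrite !exprMn exprVn (sqr_sqrtr (ler0n R 2)) !mulrA; congr (_ * _ / _)%R.
by field.
Qed.

Lemma D_TV_bound : D_TV (nu_target S k) (pushforward (ref_measure S) (Tbar S k))
  <= (2 * e / Num.sqrt z)%:E.
Proof.
rewrite /D_TV /=.
rewrite (integral_density_of (f := fun a b => `|a - b|%R) dp dq pfin qfin); last first.
  by move=> g h mg mh; apply: measurableT_comp => //; exact: measurable_funB.
have := tv_le_hellinger mp mq p0 q0 p1 q1 hell.
move=> /(lee_wpmul2l (x := 2^-1%:E)) -/(_ ltac:(by rewrite lee_fin)) /le_trans.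
by apply; rewrite -EFinM mulKf// pnatr_eq0.
Qed.

Let H := (fun x => bridge S k x ^+ 2 / pihat S k x ^+ 2)%R.

Lemma D_chi2_bound :
  D_chi2 (nu_target S k) (pushforward (ref_measure S) (Tbar S k)) <=
  ((\int[nu_target S k]_(x in spaceX S) (H x)%:E) `^ 2^-1%R +
   (\int[pushforward (ref_measure S) (Tbar S k)]_(x in spaceX S) (H x)%:E) `^ 2^-1%R) *
  (2 * zb / (z * Num.sqrt z) * e)%:E.
Proof.
(* On X the density [q] is positive, and off X both densities are 0. This gives the absolute
   continuity that selects the finite branch of [D_chi2], and [h * q = p]. *)
have q_eq0 x : q x = 0%R -> p x = 0%R.
  rewrite /q /p !patchE; case: ifPn => // /set_mem Xx /eqP.
  rewrite gt_eqF// /push_density divr_gt0 ?zbar_gt0// mulr_gt0 ?(pihat_gt0 S_ok)//.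
  exact: lam_gt0.
rewrite /D_chi2 asboolT; last exact: density_null_dominates dp dq q_eq0.
rewrite (integral_density_of (f := fun a b => ((a / b) ^+ 2 * b)%R) dp dq pfin qfin); last first.
  move=> g h mg mh; apply: measurable_funM => //; apply: measurable_funX.
  by apply: measurable_funM => //; exact: measurable_invr.
pose h x := (p x / q x)%R.
have mh : measurable_fun setT h by apply: measurable_funM => //; exact: measurable_invr.
have h0 x : (0 <= h x)%R by rewrite divr_ge0.
have hq x : (h x * q x = p x)%R.
  by have [qx|qx] := eqVneq (q x) 0%R; [rewrite qx mulr0 q_eq0|rewrite divfK].
apply: (le_trans (chi2_le_hellinger mp mq p0 q0 p1 hell mh h0 hq)).
have mH : measurable_fun (spaceX S) H.
  apply: measurable_funM; first by apply: measurable_funX; exact: (measurable_bridge S_ok).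
  by apply: measurable_invr; apply: measurable_funX; exact: measurable_pihat.
have H0 x : spaceX S x -> (0 <= H x)%R by move=> Xx; rewrite divr_ge0 ?sqr_ge0.
(* On X, [h^2 = (zb / z)^2 * H], as [lam] cancels. The square root lets out the factor [zb / z],
   which multiplies [delta = 2 e / sqrt z] to the constant claimed. *)
have hE m r : is_density m r -> (forall x, ~ spaceX S x -> r x = 0%R) ->
    (\int[leb d]_x (h x ^+ 2 * r x)%:E) `^ 2^-1%R =
    (zb / z)%:E * (\int[m]_(x in spaceX S) (H x)%:E) `^ 2^-1%R.
  move=> dr r0; rewrite (integral_is_density dr mX mH H0); have [mr rge0 _] := dr.
  have -> : (zb / z)%:E = ((zb / z) ^+ 2)%:E `^ 2^-1%R.
    rewrite poweR_EFin powR12_sqrt ?sqr_ge0// sqrtr_sqr ger0_norm//.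
    by rewrite divr_ge0 ?ltW.
  rewrite -poweRM ?lee_fin ?sqr_ge0//; last first.
    apply: integral_ge0 => x _; rewrite lee_fin mulr_ge0//.
    by rewrite patchE; case: ifPn => // /set_mem /H0.
  rewrite -ge0_integralZl//; last 3 first.
  - apply/measurable_EFinP; apply: measurable_funM => //.
    exact: (measurable_restrictT H mX).1.
  - move=> x _; rewrite lee_fin mulr_ge0//.
    by rewrite patchE; case: ifPn => // /set_mem /H0.
  - by rewrite lee_fin sqr_ge0.
  congr (_ `^ _); apply: eq_integral => x _; rewrite -EFinM; congr EFin.
  rewrite /h /p /q /H !patchE; case: ifPn => [/set_mem Xx|/negP nXx]; last first.
    by rewrite r0 ?mulr0// => Xx; apply: nXx; rewrite inE.
  rewrite mulrA; congr (_ * _)%R; rewrite /target_density /push_density -/z -/zb.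
  have := lam_gt0 S_ok Xx; have := pihat_gt0 S_ok k_le Xx => h_gt0 l_gt0.
  by field; rewrite !gt_eqF.
rewrite (hE _ _ dp); last by move=> x nX; rewrite /p patchE memNset.
rewrite (hE _ _ dq); last by move=> x nX; rewrite /q patchE memNset.
rewrite -muleDr ?ge0_adde_def ?inE ?poweR_ge0// (muleC (zb / z)%:E) -muleA -EFinM.
rewrite le_eqVlt; apply/orP; left; apply/eqP; congr (_ * _%:E).
by rewrite /delta invfM; ring.
Qed.

End main_bounds.

Theorem corollary4 (R : realType) (d : nat) (d_gt0 : (0 < d)%N)
    (S : dirt R d) (S_ok : dirt_assumptions S)
    (k : nat) (k_le : (k <= nlayers S)%N)
    (a : ratio_approach) (eps : nat -> R)
    (constructed : forall j, (j <= k)%N -> approximates S a (eps j) j)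
    (e : R)
    (err : (L2norm (spaceX S) (lam S)
              (fun x => Num.sqrt (bridge S k x) - Num.sqrt (pihat S k x))%R
            <= e%:E)%E) :
  let push := pushforward (ref_measure S) (Tbar S k) in
  let h x := (bridge S k x ^+ 2 / pihat S k x ^+ 2)%:E in
  [/\ (D_H (nu_target S k) push
         <= (Num.sqrt 2 * e / Num.sqrt (znorm S k))%:E)%E,
      (D_TV (nu_target S k) push
         <= (2 * e / Num.sqrt (znorm S k))%:E)%E &
      (D_chi2 (nu_target S k) push
         <= ((\int[nu_target S k]_(x in spaceX S) h x) `^ 2^-1%R
             + (\int[push]_(x in spaceX S) h x) `^ 2^-1%R)
            * (2 * zbar S k / (znorm S k * Num.sqrt (znorm S k)) * e)%:E)%E].
Proof.
move=> push h; split.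
- exact: (D_H_bound S_ok k_le err).
- exact: (D_TV_bound S_ok k_le err).
- exact: (D_chi2_bound S_ok k_le err).
Qed.
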